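(* Let $\kappa>0$, $h\in(0,1]$, $b\in(-\infty,0)$, and let $\xi=(\xi(x))_{x\in\mathbb{Z}}$ be non-constant i.i.d. with law $\mathrm{Prob}=\eta^{\mathbb{Z}}$, where $\eta$ is a probability measure on $[b,0]$, and $\operatorname{ess\,sup}\xi(0)=0$. Then the annealed Lyapunov exponents converge to the quenched one: $$\lim_{p\downarrow0}\lambda_p=\lambda_0.$$
   Context: Expectation with respect to $\mathrm{Prob}$ is denoted $\langle\cdot\rangle$. Let $\Delta_h f(x)=\frac{1+h}{2}(f(x+1)-f(x))+\frac{1-h}{2}(f(x-1)-f(x))$. For fixed $\xi$, $u$ is the unique bounded non-negative solution of $\partial_t u(t,x)=\kappa\Delta_h u(t,x)+\xi(x)u(t,x)$ on $\mathbb{R}_+\times\mathbb{Z}$, $u(0,\cdot)\equiv1$; in particular $u(t,0)=\mathbb{E}_0\exp\{\int_0^t\xi(X_s)\,ds\}$, where $X$ is the continuous-time random walk on $\mathbb{Z}$ started at $0$ with generator $\kappa\Delta_h$, independent of $\xi$. The quenched Lyapunov exponent is $\lambda_0=\lim_{t\to\infty}\frac1t\log u(t,0)$ (a.s. limit, non-random) and for $p\in(0,\infty)$ the $p$-th annealed Lyapunov exponent is $\lambda_p=\lim_{t\to\infty}\frac1t\log\langle u(t,0)^p\rangle^{1/p}$; under the present assumptions all these limits exist. *)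

(* Defs.v *)
From HB Require Import structures.
From mathcomp Require Import all_boot all_order all_algebra.
From mathcomp Require Import all_classical all_reals all_analysis.
Set Implicit Arguments.
Unset Strict Implicit.
Unset Printing Implicit Defensive.
Import Order.TTheory GRing.Theory Num.Theory.
Import numFieldNormedType.Exports.
Local Open Scope classical_set_scope.
Local Open Scope ring_scope.

Definition drift_laplacian (R : realType) (h : R) (f : int -> R) (x : int) : R :=
  (1 + h) / 2 * (f (x + 1) - f x) + (1 - h) / 2 * (f (x - 1) - f x).

(* Only the values [v t x] with [0 <= t] are constrained. The initial condition
   is attained continuously and the equation holds at every [t > 0]; the
   one-sided equation at [t = 0] is then automatic. *)
Record pam_solution (R : realType) (kappa h : R) (V : int -> R)
    (v : R -> int -> R) : Prop := PamSolution {
  pam_init : forall x, v 0 x = 1 ;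
  pam_continuous : forall x, {within `[0, +oo[, continuous (fun t : R => v t x)} ;
  pam_eq : forall (t : R) x, 0 < t ->
    is_derive t 1 (fun s : R => v s x)
      (kappa * drift_laplacian h (v t) x + V x * v t x) ;
  pam_ge0 : forall (t : R) x, 0 <= t -> 0 <= v t x ;
  pam_bounded : exists M : R, forall (t : R) x, 0 <= t -> v t x <= M }.

Definition mutually_independent (d : measure_display) (T : measurableType d)
    (R : realType) (P : probability T R) (xi : int -> {RV P >-> R}) : Prop :=
  forall (J : seq int) (A : int -> set R), uniq J ->
    (forall x, measurable (A x)) ->
    P (\bigcap_(x in [set` J]) xi x @^-1` A x) =
    (\prod_(x <- J) P (xi x @^-1` A x))%E.

Definition has_law (d : measure_display) (T : measurableType d)
    (R : realType) (P : probability T R) (X : {RV P >-> R})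
    (eta : probability R R) : Prop :=
  forall A : set R, measurable A -> distribution P X A = eta A.

Definition is_quenched_lyapunov (d : measure_display) (T : measurableType d)
    (R : realType) (P : probability T R) (u : T -> R -> int -> R)
    (l : R) : Prop :=
  {ae P, forall w, t^-1 * ln (u w t 0) @[t --> +oo] --> l}.

(* [fine] is harmless for the bounded non-negative [u] considered here: the
   p-th moment is then finite. *)
Definition is_annealed_lyapunov (d : measure_display) (T : measurableType d)
    (R : realType) (P : probability T R) (u : T -> R -> int -> R)
    (p l : R) : Prop :=
  t^-1 * ln (fine 'E_P[fun w => u w t 0 `^ p] `^ p^-1) @[t --> +oo] --> l.

(* Main.v *)
(* For beta > -kappa and an environment xi, the ratios U(x) / U(x + 1) of solutions
   of kappa Delta_h U + (xi - beta) U = 0 growing to the right obey a Riccati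
   recursion which reads off the environment from left to right and forgets its
   starting value exponentially fast. Both exponents are governed by the products
   of these ratios.

   Quenched bound. If beta > lambda_0, the Laplace transform of u(., x) at beta is
   a finite supersolution on the sites x >= 0, bounded below, so almost surely the
   products of the ratios are bounded; hence the mean of the logarithm of the
   product over n sites is o(n). On a long stretch of sites where xi is almost 0
   no positive supersolution exists for beta < -kappa + kappa sqrt(1 - h^2), whence
   lambda_0 >= -kappa + kappa sqrt(1 - h^2); above this value the recursion contracts.

   Annealed bound. Raising beta slightly makes the mean logarithm of the product
   over some number m of sites strictly negative, whatever the starting value, so
   the s-th moment of that product is below 1 for all small s, and by independence
   and monotonicity in the starting value the s-th moments of the products over n
   sites are summable in n. Since sup_(s <= t) exp(- beta s) u(s, x) is a
   subsolution, u(t, 0) exp(- beta t) is bounded by a sum of such products, which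
   gives lambda_s <= beta.

   The inequality lambda_0 <= lambda_s is Chebyshev's inequality. In order to work
   with finitely many values only, the environment is rounded to a grid. *)
Require Import Defs.
From mathcomp Require Import all_boot all_order all_algebra.
From mathcomp Require Import all_classical all_reals all_analysis ess_sup_inf.
From mathcomp Require Import measurable_realfun ring lra.
Import Order.TTheory GRing.Theory Num.Theory.
Import numFieldNormedType.Exports.
Local Open Scope classical_set_scope.
Local Open Scope ring_scope.
Set Implicit Arguments.
Unset Strict Implicit.
Unset Printing Implicit Defensive.

(** * Calculus on the half-line *)

Lemma ge_cvgn (R : realType) (u : nat -> R) (l x : R) :
  u n @[n --> \oo] --> l -> (forall n, x <= u n) -> x <= l.
Proof.
move=> ul xu; rewrite -(cvg_lim _ ul)//; apply: limr_ge; first exact: cvgP ul.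
exact: nearW.
Qed.


(** Solutions are constrained at nonnegative times only: a derivative is required for [t > 0] and
    right continuity at [0], which is enough for monotonicity arguments starting at time [0]. *)
Definition diff_on_pos (R : realType) (f df : R -> R) : Prop :=
  f t @[t --> (0 : R)^'+] --> f 0 /\ forall t : R, 0 < t -> is_derive t 1 f (df t).

Lemma diff_on_pos_cts (R : realType) (f df : R -> R) (t : R) :
  diff_on_pos f df -> 0 < t -> {for t, continuous f}.
Proof.
move=> [_ fd] t0; apply: differentiable_continuous.
by apply/derivable1_diffP; have [] := fd _ t0.
Qed.

Lemma diff_on_pos_within (R : realType) (f df : R -> R) (a b : R) :
  diff_on_pos f df -> 0 <= a -> a < b -> {within `[a, b], continuous f}.
Proof.
move=> fd a0 ab; have b0 := le_lt_trans a0 ab.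
apply/continuous_within_itvP => //; split.
- move=> x /itvP xab; apply: (@diff_on_pos_cts _ _ df) => //.
  by apply: (le_lt_trans a0); rewrite xab.
- move: a0; rewrite le_eqVlt => /predU1P[<-|a0]; first exact: fd.1.
  by apply/cvg_at_right_filter; exact: (@diff_on_pos_cts _ _ df).
- by apply/cvg_at_left_filter; exact: (@diff_on_pos_cts _ _ df).
Qed.

Lemma ge0_derive_ndecr (R : realType) (f df : R -> R) (a b : R) :
  diff_on_pos f df -> 0 <= a -> a <= b ->
  (forall t, a < t -> t < b -> 0 <= df t) -> f a <= f b.
Proof.
move=> fd a0; rewrite le_eqVlt => /predU1P[->//|ab] df0.
have tpos t : t \in `]a, b[ -> 0 < t.
  by move=> /itvP tab; apply: (le_lt_trans a0); rewrite tab.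
apply: (@ger0_derive1_ndecr R f a b) => //; last 2 first.
- exact: (@diff_on_pos_within _ _ df).
- exact: ltW.
- by move=> x /tpos x0; have [] := fd.2 _ x0.
- move=> x xab; have [_ fx] := fd.2 _ (tpos _ xab).
  by rewrite derive1E fx; apply: df0; move/itvP: xab => ->.
Qed.

Lemma diff_on_posD (R : realType) (f g df dg : R -> R) :
  diff_on_pos f df -> diff_on_pos g dg ->
  diff_on_pos (fun t => f t + g t) (fun t => df t + dg t).
Proof.
move=> [f0 fd] [g0 gd]; split; first exact: cvgD.
by move=> t t0; have ? := fd _ t0; have ? := gd _ t0; exact: is_deriveD.
Qed.

Lemma diff_on_posM (R : realType) (f g df dg : R -> R) :
  diff_on_pos f df -> diff_on_pos g dg ->
  diff_on_pos (fun t => f t * g t) (fun t => f t * dg t + df t * g t).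
Proof.
move=> [f0 fd] [g0 gd]; split; first exact: cvgM.
move=> t t0; have ? := fd _ t0; have ? := gd _ t0.
by apply: is_derive_eq; rewrite /GRing.scale/= (mulrC (df t)).
Qed.

Lemma diff_on_pos_cst (R : realType) (c : R) :
  diff_on_pos (fun=> c) (fun=> 0).
Proof. by split; [exact: cvg_cst|move=> t _; exact: is_derive_cst]. Qed.

Lemma diff_on_pos_eq (R : realType) (f df dg : R -> R) :
  diff_on_pos f df -> (forall t, 0 < t -> df t = dg t) ->
  diff_on_pos f dg.
Proof. by move=> [f0 fd] e; split=> // t t0; rewrite -e//; exact: fd. Qed.

Lemma diff_on_pos_ext (R : realType) (f g df : R -> R) :
  diff_on_pos f df -> f =1 g -> diff_on_pos g df.
Proof. by move=> fd /funext <-. Qed.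

Lemma diff_on_posZ (R : realType) (f df : R -> R) (c : R) :
  diff_on_pos f df -> diff_on_pos (fun t => c * f t) (fun t => c * df t).
Proof.
move=> fd; apply: (diff_on_pos_eq (diff_on_posM (diff_on_pos_cst c) fd)).
by move=> t _; rewrite mul0r addr0.
Qed.

Lemma diff_on_pos_is_derive (R : realType) (f df : R -> R) :
  (forall t : R, is_derive t 1 f (df t)) -> diff_on_pos f df.
Proof.
move=> fd; split; last by move=> t _; exact: fd.
apply/cvg_at_right_filter/differentiable_continuous.
by apply/derivable1_diffP; have [] := fd 0.
Qed.

Lemma diff_on_pos_exp (R : realType) (c : R) :
  diff_on_pos (fun t => expR (c * t)) (fun t => c * expR (c * t)).
Proof.
apply: diff_on_pos_is_derive => t.
have h : is_derive t 1 (fun s : R => c * s) c.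
  by apply: is_derive_eq; rewrite /GRing.scale/= mulr1.
have := @is_derive1_comp R expR (fun s => c * s) t _ _ (is_derive_expR (c * t)) h.
rewrite /comp.
by rewrite mulrC.
Qed.

(** The function [expR (- c * t) * f t] is nondecreasing on the interval. *)
Lemma gronwall_ge (R : realType) (f df : R -> R) (c a b : R) :
  diff_on_pos f df -> 0 <= a -> a <= b ->
  (forall t, a < t -> t < b -> c * f t <= df t) ->
  expR (c * (b - a)) * f a <= f b.
Proof.
move=> fd a0 ab h.
have gd := diff_on_posM (diff_on_pos_exp (- c)) fd.
have /= := ge0_derive_ndecr gd a0 ab.
move=> H; have {}H := H _.
have : expR (- c * a) * f a <= expR (- c * b) * f b.
  apply: H => t ta tb; have := h _ ta tb => k.
  rewrite (_ : _ + _ = expR (- c * t) * (df t - c * f t)); last by ring.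
  by rewrite mulr_ge0 ?expR_ge0// subr_ge0.
rewrite mulrBr expRD -(ler_pM2l (expR_gt0 (c * b))) !mulrA -!expRD.
rewrite (_ : c * b + - c * b = 0) ?expR0 ?mul1r ?mulNr//; ring.
Qed.

Lemma diff_on_pos_id (R : realType) : diff_on_pos (fun s : R => s) (fun=> 1).
Proof. by apply: diff_on_pos_is_derive => s; exact: is_derive_id. Qed.

Lemma diff_on_posX (R : realType) (n : nat) :
  diff_on_pos (fun t : R => t ^+ n.+1) (fun t => n.+1%:R * t ^+ n).
Proof.
elim: n => [|n IH].
  apply: diff_on_pos_eq (diff_on_pos_id R) _ => t _.
  by rewrite expr0 mulr1.
apply: diff_on_pos_eq (diff_on_posM (diff_on_pos_id R) IH) _ => t _.
by rewrite [in RHS]mulrSr exprS; ring.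
Qed.

(** * Ratios of solutions of the elliptic equation *)

Section ratio.
Context {R : realType}.
Variables (p q a0 : R).
Hypotheses (p_gt0 : 0 < p) (q_ge0 : 0 <= q) (qp : q < p) (a0_gt0 : 0 < a0).
Hypothesis a0_pq : 4 * p * q < a0 ^+ 2.

(* If [a * U x = p * U (x + 1) + q * U (x - 1)] and [U (x - 1) = r * U x], then
   [U x = ratio_step a r * U (x + 1)]. With [a = kappa + beta - xi x] this is the
   recursion satisfied by [E_x exp(int_0^T (xi (X_s) - beta) ds)], where [T] is
   the hitting time of [x + 1]. *)
Definition ratio_step (a r : R) : R := p / (a - q * r).

Fixpoint ratio_prod (r : R) (l : seq R) : R :=
  if l is a :: l' then ratio_step a r * ratio_prod (ratio_step a r) l' else 1.

Fixpoint ratio_last (r : R) (l : seq R) : R :=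
  if l is a :: l' then ratio_last (ratio_step a r) l' else r.

(* Not the fixed point of [ratio_step a0] but a simpler upper barrier for it. *)
Definition ratio_max : R := 2 * p / a0.

Lemma ratio_max_gt0 : 0 < ratio_max.
Proof. by rewrite divr_gt0// mulr_gt0. Qed.

Lemma ratio_maxE : a0 * ratio_max = 2 * p.
Proof. by rewrite mulrC divfK// gt_eqF. Qed.

(** The discriminant condition [4 * p * q < a0 ^+ 2] enters here: a ratio up to [ratio_max] uses up
    at most half of [a0] in the denominator [a - q * r], which makes [ratio_max] a barrier. *)
Lemma q_ratio_max : q * ratio_max <= a0 / 2.
Proof.
rewrite /ratio_max mulrA ler_pdivrMr//; have := a0_pq; rewrite expr2; lra.
Qed.

Lemma ratio_den_ge a r : a0 <= a -> r <= ratio_max -> a0 / 2 <= a - q * r.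
Proof.
move=> aa rm; have := q_ratio_max.
have := ler_wpM2l q_ge0 rm; lra.
Qed.

Lemma ratio_den_gt0 a r : a0 <= a -> r <= ratio_max -> 0 < a - q * r.
Proof.
by move=> aa rm; apply: lt_le_trans (ratio_den_ge aa rm); rewrite divr_gt0.
Qed.

Lemma ratio_step_gt0 a r : a0 <= a -> r <= ratio_max -> 0 < ratio_step a r.
Proof. by move=> aa rm; rewrite divr_gt0// ratio_den_gt0. Qed.

Lemma ratio_step_le_max a r : a0 <= a -> r <= ratio_max ->
  ratio_step a r <= ratio_max.
Proof.
move=> aa rm; rewrite ler_pdivrMr ?ratio_den_gt0//.
have := ler_wpM2l (ltW ratio_max_gt0) (ratio_den_ge aa rm).
have := ratio_maxE; lra.
Qed.

Lemma ratio_step_le a r r' : a0 <= a -> r <= r' -> r' <= ratio_max ->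
  ratio_step a r <= ratio_step a r'.
Proof.
move=> aa rr rm; have rm' := le_trans rr rm.
rewrite ler_pM2l// lef_pV2 ?posrE ?ratio_den_gt0//.
by rewrite lerD2l lerN2 ler_wpM2l.
Qed.

Lemma ratio_prod_gt0 r l : all (>= a0) l -> r <= ratio_max ->
  0 < ratio_prod r l.
Proof.
elim: l r => //= a l IH r /andP[aa al] rm.
by rewrite mulr_gt0 ?ratio_step_gt0// IH// ratio_step_le_max.
Qed.

Lemma ratio_prod_le r r' l : all (>= a0) l -> r <= r' -> r' <= ratio_max ->
  ratio_prod r l <= ratio_prod r' l.
Proof.
elim: l r r' => //= a l IH r r' /andP[aa al] rr rm; have rm' := le_trans rr rm.
have sm := ratio_step_le_max aa rm; have sm' := ratio_step_le_max aa rm'.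
apply: ler_pM; rewrite ?ratio_step_le//.
- exact/ltW/ratio_step_gt0.
- exact/ltW/ratio_prod_gt0.
- by apply: IH; rewrite ?ratio_step_le.
Qed.

Lemma ratio_last_le_max r l : all (>= a0) l -> r <= ratio_max ->
  ratio_last r l <= ratio_max.
Proof.
elim: l r => //= a l IH r /andP[aa al] rm.
by apply: IH => //; exact: ratio_step_le_max.
Qed.

Lemma ratio_prod_cat r l l' :
  ratio_prod r (l ++ l') = ratio_prod r l * ratio_prod (ratio_last r l) l'.
Proof.
by elim: l r => [|a l IH] r /=; rewrite ?mul1r// IH mulrA.
Qed.

(** Restarting from the largest admissible ratio can only increase the second factor; this cuts a
    long product into separate blocks. *)
Lemma ratio_prod_cat_le l l' : all (>= a0) l -> all (>= a0) l' ->
  ratio_prod ratio_max (l ++ l') <=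
  ratio_prod ratio_max l * ratio_prod ratio_max l'.
Proof.
move=> al al'; rewrite ratio_prod_cat ler_pM2l ?ratio_prod_gt0//.
by rewrite ratio_prod_le// ratio_last_le_max.
Qed.

Lemma ratio_prod_le_exp r l : all (>= a0) l -> r <= ratio_max ->
  ratio_prod r l <= ratio_max ^+ size l.
Proof.
elim: l r => //= a l IH r /andP[aa al] rm; rewrite exprS.
have sm := ratio_step_le_max aa rm.
apply: ler_pM => //.
- exact/ltW/ratio_step_gt0.
- exact/ltW/ratio_prod_gt0.
- exact: IH.
Qed.

(* The map [r |-> p / (a - q r)] contracts [0, ratio_max] with this constant. *)
Let c := 4 * p * q / a0 ^+ 2.

Let c_ge0 : 0 <= c.
Proof. by rewrite divr_ge0 ?exprn_ge0 ?mulr_ge0// ltW. Qed.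

Let c_lt1 : c < 1.
Proof. by rewrite ltr_pdivrMr ?mul1r// exprn_gt0. Qed.

Lemma ratio_step_contract a r r' (D : R) : a0 <= a -> r <= ratio_max ->
  r' <= ratio_max -> 0 <= D -> r' - r <= D ->
  ratio_step a r' - ratio_step a r <= c * D.
Proof.
move=> aa rm rm' D0 rD.
have d0 := ratio_den_gt0 aa rm; have d0' := ratio_den_gt0 aa rm'.
have dg := ratio_den_ge aa rm; have dg' := ratio_den_ge aa rm'.
have -> : ratio_step a r' - ratio_step a r =
    p * q / ((a - q * r) * (a - q * r')) * (r' - r).
  by rewrite /ratio_step; field; rewrite !gt_eqF.
have k0 : 0 <= p * q / ((a - q * r) * (a - q * r')).
  by rewrite divr_ge0// mulr_ge0// ltW.
apply: (le_trans (ler_wpM2l k0 rD)); apply: ler_wpM2r => //.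
have -> : c = p * q / ((a0 / 2) * (a0 / 2)).
  by rewrite /c; field; rewrite gt_eqF.
apply: ler_wpM2l; first by rewrite mulr_ge0// ltW.
rewrite lef_pV2 ?posrE ?mulr_gt0 ?divr_gt0//.
by apply: ler_pM => //; rewrite divr_ge0// ltW.
Qed.

(* Raising every entry by [d] beats any change of the starting value. *)
Lemma ratio_prod_shift (A d : R) : 0 < d -> a0 <= A ->
  exists C, exists2 th : R, 0 < th < 1 & 0 < C /\
  forall l, all (fun a => a0 <= a <= A) l ->
  ratio_prod ratio_max [seq a + d | a <- l] <= C * th ^+ size l * ratio_prod 0 l.
Proof.
move=> d0 aA; have A0 : 0 < A by exact: lt_le_trans aA.
(* The denominator [a - q * r'] is at most [A], so adding [d] to it shrinks a step by at least this
   factor. *)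
pose th := A / (A + d).
have th0 : 0 < th by rewrite divr_gt0// addr_gt0.
have th1 : th < 1 by rewrite ltr_pdivrMr ?addr_gt0// mul1r ltrDl.
(* A step pays [expR (K * D)] for a discrepancy [D] of the starting values; contraction then
   replaces [D] by [c * D], and [K'] sums the resulting geometric series. *)
pose K := q / (a0 / 2).
have K0 : 0 <= K by rewrite divr_ge0// ltW// divr_gt0.
pose K' := K / (1 - c).
have c1 : 0 < 1 - c by rewrite subr_gt0.
have K'0 : 0 <= K' by rewrite divr_ge0// ltW.
have K'E : K + K' * c = K' by rewrite /K'; field; rewrite gt_eqF.
exists (expR (K' * ratio_max)), th; first by rewrite th0.
split; first exact: expR_gt0.
suff H l r r' D : all (fun a => a0 <= a <= A) l -> 0 <= r -> r <= ratio_max ->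
    0 <= r' -> r' <= ratio_max -> 0 <= D -> r' - r <= D ->
    ratio_prod r' [seq a + d | a <- l] <=
      expR (K' * D) * th ^+ size l * ratio_prod r l.
  move=> l al; have m0 := ltW ratio_max_gt0.
  by apply: H; rewrite // ?subr0.
elim: l r r' D => [|a l IH] r r' D /=.
  move=> _ _ _ _ _ D0 _; rewrite mulr1 mulr1.
  by apply: (le_trans _ (expR_ge1Dx _)); rewrite lerDl mulr_ge0.
move=> /andP[/andP[aa aA'] al] r0 rm r0' rm' D0 rD.
have aad : a0 <= a + d by rewrite (le_trans aa)// lerDl ltW.
have ale : all (>= a0) l by apply: sub_all al => x /andP[].
have aled : all (>= a0) [seq a + d | a <- l].
  rewrite all_map; apply: sub_all ale => x /= xx.
  by rewrite (le_trans xx)// lerDl ltW.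
have sm := ratio_step_le_max aa rm; have sm' := ratio_step_le_max aad rm'.
have step : ratio_step (a + d) r' <= expR (K * D) * th * ratio_step a r.
  have d1 := ratio_den_gt0 aa rm; have d2 := ratio_den_gt0 aad rm'.
  have d3 := ratio_den_gt0 aa rm'; have d4 := ratio_den_ge aa rm'.
  have qD : q * (r' - r) <= q * D by exact: ler_wpM2l.
  have Ythd : a - q * r' <= th * (a + d - q * r').
    rewrite /th mulrAC ler_pdivlMr ?addr_gt0//.
    have : (a - q * r') * d <= A * d by rewrite ler_pM2r// ; have := mulr_ge0 q_ge0 r0'; lra.
    lra.
  have YK : q <= K * (a - q * r').
    by rewrite /K mulrAC ler_pdivlMr ?divr_gt0// ler_wpM2l.
  have XY : a - q * r <= (1 + K * D) * (a - q * r').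
    have := ler_wpM2r D0 YK; lra.
  have E1 := expR_ge1Dx (K * D).
  have XE : a - q * r <= expR (K * D) * (th * (a + d - q * r')).
    apply: (le_trans XY); apply: ler_pM => //; last exact: ltW.
    by rewrite addr_ge0// mulr_ge0.
  rewrite /ratio_step mulrA ler_pdivlMr// mulrAC ler_pdivrMr//.
  rewrite -(ler_pM2l p_gt0) in XE; lra.
have step0 : 0 <= ratio_step a r by exact/ltW/ratio_step_gt0.
apply: le_trans (_ : (expR (K * D) * th * ratio_step a r) *
  (expR (K' * (c * D)) * th ^+ size l * ratio_prod (ratio_step a r) l) <= _).
  apply: ler_pM => //.
  - exact/ltW/ratio_step_gt0.
  - exact/ltW/ratio_prod_gt0.
  apply: IH => //; first exact/ltW/ratio_step_gt0.
    by rewrite mulr_ge0.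
  apply: le_trans (ratio_step_contract aa rm rm' D0 rD).
  rewrite lerD2r /ratio_step ler_pM2l// lef_pV2 ?posrE ?ratio_den_gt0//.
  by rewrite -addrA lerD2l lerDr ltW.
rewrite exprS -[in leRHS]K'E mulrDl expRD !mulrA.
rewrite le_eqVlt; apply/orP; left; apply/eqP; ring.
Qed.

End ratio.

(** * Estimates for the parabolic equation *)

Lemma pam_diff (R : realType) (kappa h : R) (V : int -> R) (v : R -> int -> R)
    (sol : pam_solution kappa h V v) x :
  diff_on_pos (v ^~ x) (fun t => kappa * ((1 + h) / 2) * v t (x + 1) +
    kappa * ((1 - h) / 2) * v t (x - 1) - (kappa - V x) * v t x).
Proof.
split; last first.
  move=> t t0; apply: (@is_derive_eq _ _ _ _ _ _ _ _ (pam_eq sol x t0)).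
  by rewrite /drift_laplacian; field.
have vc : {within `[0, +oo[, continuous (v ^~ x)} by exact: (pam_continuous sol).
by have /continuous_within_itvcyP[] := vc.
Qed.

Section pam.
Context {R : realType}.
Variables (p q kappa b : R) (V : int -> R) (v : R -> int -> R).
Hypotheses (p_gt0 : 0 < p) (q_ge0 : 0 <= q) (pqE : p + q = kappa).
Hypothesis V_itv : forall x, b <= V x <= 0.
Hypothesis v_init : forall x, v 0 x = 1.
Hypothesis v_diff : forall x, diff_on_pos (v ^~ x)
  (fun t => p * v t (x + 1) + q * v t (x - 1) - (kappa - V x) * v t x).
Hypothesis v_ge0 : forall t x, 0 <= t -> 0 <= v t x.
Hypothesis v_bounded : exists M : R, forall (t : R) x, 0 <= t -> v t x <= M.

Let kappa_gt0 : 0 < kappa.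
Proof. by rewrite -pqE ltr_wpDr. Qed.

(* A bound [v <= 1 + B] on [0, t] improves to [v <= 1 + B (1 - exp (- kappa t))]. *)
Lemma pam_le1 t x : 0 <= t -> v t x <= 1.
Proof.
move=> t0; have [M vM] := v_bounded.
have [B B0 vB] : exists2 B, 0 <= B & forall s x, 0 <= s -> v s x <= 1 + B.
  exists `|M| => // s y s0; apply: (le_trans (vM _ y s0)).
  by apply: (le_trans (ler_norm _)); rewrite lerDr.
pose r := 1 - expR (- kappa * t).
have r0 : 0 <= r.
  by rewrite subr_ge0 -expR0 ler_expR mulNr oppr_le0 mulr_ge0// ltW.
have r1 : r < 1 by rewrite ltrBlDr ltrDl expR_gt0.
have vn n : forall s y, 0 <= s -> s <= t -> v s y <= 1 + B * r ^+ n.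
  elim: n => [|n IH] s y s0 st; first by rewrite mulr1; exact: vB.
  have gd := diff_on_posD (diff_on_pos_cst (1 + B * r ^+ n))
    (diff_on_posZ (-1) (v_diff y)).
  have Br : 0 <= B * r ^+ n by rewrite mulr_ge0// exprn_ge0.
  have /= := gronwall_ge (c := - kappa) gd (lexx 0) s0.
  rewrite v_init subr0 => H.
  have {H} : expR (- kappa * s) * (1 + B * r ^+ n + -1 * 1) <=
      1 + B * r ^+ n + -1 * v s y.
    apply: H => u u0 us; have ut := ltW (lt_le_trans us st).
    have k1 := ler_wpM2l (ltW p_gt0) (IH u (y + 1) (ltW u0) ut).
    have k2 := ler_wpM2l q_ge0 (IH u (y - 1) (ltW u0) ut).
    have k3 : V y * v u y <= 0.
      by have /andP[_ Vy] := V_itv y; rewrite mulr_le0_ge0// v_ge0// ltW.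
    rewrite -pqE; lra.
  have : expR (- kappa * t) <= expR (- kappa * s).
    by rewrite ler_expR ler_nM2l// oppr_lt0.
  move=> /(ler_wpM2r Br); rewrite exprSr mulrA /r; lra.
have cv : 1 + B * r ^+ n @[n --> \oo] --> 1 + B * 0.
  apply: cvgD; first exact: cvg_cst.
  by apply: cvgMr; apply: cvg_expr; rewrite ger0_norm.
have := ge_cvgn cv (fun n => vn n t x t0 (lexx t)).
by rewrite mulr0 addr0.
Qed.

(** Dropping the nonnegative jump terms leaves a decay rate of at most [kappa - b]. *)
Lemma pam_growth t s x : 0 <= t -> t <= s ->
  expR (- (kappa - b) * (s - t)) * v t x <= v s x.
Proof.
move=> t0 ts; apply: (gronwall_ge (v_diff x)) => // u tu us.
have u0 : 0 <= u by exact/(le_trans t0)/ltW.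
have k1 := mulr_ge0 (ltW p_gt0) (v_ge0 (x + 1) u0).
have k2 := mulr_ge0 q_ge0 (v_ge0 (x - 1) u0).
have /andP[bV _] := V_itv x.
have := ler_wpM2r (v_ge0 x u0) bV; lra.
Qed.

Lemma pam_gt t x : 0 <= t -> expR (- (kappa - b) * t) <= v t x.
Proof.
by move=> t0; have := pam_growth x (lexx 0) t0; rewrite v_init subr0 mulr1.
Qed.

(** The derivative of [expR (c * s) * v s x] is at least [p * expR (c * s) * v s (x + 1)], which by
    [pam_growth] stays above its value at [s = t]; this is integrated over a unit of time. *)
Lemma pam_neighbour t x : 0 <= t ->
  p * expR (- (kappa - b)) * v t (x + 1) <= v (t + 1) x.
Proof.
move=> t0; set c := kappa - b; have t1 : t <= t + 1 by rewrite lerDl.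
have gd := diff_on_posD (diff_on_posM (diff_on_pos_exp c) (v_diff x))
    (diff_on_posZ (- (p * expR (c * t) * v t (x + 1))) (diff_on_pos_id R)).
have /= H := ge0_derive_ndecr gd t0 t1.
have {}H := H _.
have : expR (c * t) * v t x <=
    expR (c * (t + 1)) * v (t + 1) x - p * expR (c * t) * v t (x + 1).
  rewrite -(lerD2r (- (p * expR (c * t) * v t (x + 1)) * t)).
  apply: (le_trans (H _)); last by lra.
  move=> s ts st; have s0 : 0 <= s by exact/(le_trans t0)/ltW.
  have k1 : p * expR (c * t) * v t (x + 1) <= p * expR (c * s) * v s (x + 1).
    have /(ler_wpM2l (ltW p_gt0)) := pam_growth (x + 1) t0 (ltW ts).
    move=> /(ler_wpM2l (expR_ge0 (c * s))) k.
    apply: le_trans (le_trans _ k) _; last by rewrite mulrCA mulrA.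
    rewrite le_eqVlt; apply/orP; left; apply/eqP.
    rewrite (_ : expR (c * t) = expR (c * s) * expR (- (kappa - b) * (s - t))).
      by ring.
    by rewrite -expRD -/c; congr expR; ring.
  have k2 : 0 <= expR (c * s) * (q * v s (x - 1)).
    by rewrite mulr_ge0 ?expR_ge0// mulr_ge0// v_ge0.
  have k3 : 0 <= expR (c * s) * ((V x - b) * v s x).
    have /andP[bV _] := V_itv x.
    by rewrite mulr_ge0 ?expR_ge0// mulr_ge0 ?v_ge0// subr_ge0.
  rewrite /c in k1 k2 k3 *; lra.
have k0 : 0 <= expR (c * t) * v t x by rewrite mulr_ge0 ?expR_ge0// v_ge0.
move=> /(le_trans k0); rewrite subr_ge0 -(ler_pM2l (expR_gt0 (- c * (t + 1)))).
rewrite [X in _ <= X]mulrA -expRD [X in _ <= expR X * _](_ : _ = 0); last by ring.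
rewrite expR0 mul1r; apply: le_trans.
rewrite !mulrA [X in _ <= X * _](_ : _ = p * (expR (- c * (t + 1)) * expR (c * t))); last by ring.
rewrite -expRD (_ : - c * (t + 1) + c * t = - c)//; ring.
Qed.

(* [pam_coef V k] is the [k]-th power of the generator applied to the constant
   function 1, so that the solution is [sum_k t^k / k! * pam_coef V k]. *)
Fixpoint pam_coef (V : int -> R) (n : nat) (x : int) : R :=
  if n is m.+1 then
    p * pam_coef V m (x + 1) + q * pam_coef V m (x - 1) - (kappa - V x) * pam_coef V m x
  else 1.

Definition pam_taylor (V : int -> R) (n : nat) (t : R) (x : int) : R :=
  \sum_(k < n) t ^+ k / k`!%:R * pam_coef V k x.

Lemma pam_taylor_diff n x : diff_on_pos (pam_taylor V n.+1 ^~ x)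
  (fun t => p * pam_taylor V n t (x + 1) + q * pam_taylor V n t (x - 1) -
            (kappa - V x) * pam_taylor V n t x).
Proof.
elim: n => [|n IH].
  apply: (@diff_on_pos_ext _ (fun=> 1)).
    apply: diff_on_pos_eq (diff_on_pos_cst 1) _ => t _.
    by rewrite /pam_taylor !big_ord0; ring.
  by move=> t; rewrite /pam_taylor big_ord1 expr0 fact0 divr1 mulr1.
have xn : diff_on_pos (fun t : R => t ^+ n.+1 / n.+1`!%:R * pam_coef V n.+1 x)
    (fun t => t ^+ n / n`!%:R * pam_coef V n.+1 x).
  have := diff_on_posZ (pam_coef V n.+1 x / n.+1`!%:R) (diff_on_posX R n).
  move=> /diff_on_pos_ext H; apply: diff_on_pos_eq (H _ _) _ => t; first by ring.
  move=> _; rewrite factS natrM; field.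
  by rewrite nat1r !pnatr_eq0 -lt0n fact_gt0.
apply: (@diff_on_pos_ext _ (fun t => pam_taylor V n.+1 t x +
    t ^+ n.+1 / n.+1`!%:R * pam_coef V n.+1 x)); last first.
  by move=> t; rewrite {2}/pam_taylor big_ord_recr.
apply: diff_on_pos_eq (diff_on_posD IH xn) _ => t _.
rewrite /pam_taylor !big_ord_recr/=; ring.
Qed.

(** The generator has sup norm at most [kappa + kappa - b], and the derivative of the error of order
    [n.+1] is the generator applied to the error of order [n]. The solution thus is a limit of
    polynomials in the environment, which later yields measurability. *)
Lemma pam_taylor_error n t x : 0 <= t ->
  `|v t x - pam_taylor V n t x| <= ((kappa + kappa - b) * t) ^+ n / n`!%:R.
Proof.
set L := kappa + kappa - b.
have b0 : b <= 0 by have /andP[] := V_itv 0; exact: le_trans.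
have L0 : 0 < L by rewrite /L; have := kappa_gt0; lra.
elim: n t x => [|n IH] t x t0.
  rewrite /pam_taylor big_ord0 subr0 expr0 fact0 divr1.
  by rewrite ger0_norm ?v_ge0// pam_le1.
have xn : diff_on_pos (fun t : R => (L * t) ^+ n.+1 / n.+1`!%:R)
    (fun t => L * ((L * t) ^+ n / n`!%:R)).
  have := diff_on_posZ (L ^+ n.+1 / n.+1`!%:R) (diff_on_posX R n).
  move=> /diff_on_pos_ext H; apply: diff_on_pos_eq (H _ _) _ => s.
    by rewrite exprMn; ring.
  move=> _; rewrite factS natrM exprMn exprS; field.
  by rewrite nat1r !pnatr_eq0 -lt0n fact_gt0.
have rd := diff_on_posD (v_diff x) (diff_on_posZ (-1) (pam_taylor_diff n x)).
(* The sign [e] treats the upper and the lower bound at once. *)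
have bound s (e : R) : e = 1 \/ e = -1 -> 0 <= s ->
    0 <= L * ((L * s) ^+ n / n`!%:R) + e *
     (p * v s (x + 1) + q * v s (x - 1) - (kappa - V x) * v s x +
     -1 * (p * pam_taylor V n s (x + 1) + q * pam_taylor V n s (x - 1) -
      (kappa - V x) * pam_taylor V n s x)).
  move=> e1 s0; set B := _ / _.
  have Ve : 0 <= kappa - V x.
    by have /andP[_ ?] := V_itv x; rewrite subr_ge0 (le_trans _ (ltW kappa_gt0)).
  have B0 : 0 <= B by rewrite divr_ge0// exprn_ge0// mulr_ge0// ltW.
  have /ler_normlP[u1 u2] := IH s (x + 1) s0.
  have /ler_normlP[u3 u4] := IH s (x - 1) s0.
  have /ler_normlP[u5 u6] := IH s x s0.
  have /andP[bV _] := V_itv x.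
  have Bb : 0 <= (V x - b) * B by rewrite mulr_ge0// subr_ge0.
  have := ler_wpM2l (ltW p_gt0) u1; have := ler_wpM2l (ltW p_gt0) u2.
  have := ler_wpM2l q_ge0 u3; have := ler_wpM2l q_ge0 u4.
  have := ler_wpM2l Ve u5; have := ler_wpM2l Ve u6.
  rewrite -/B /L -{1 2}pqE.
  have e0 : kappa * B = p * B + q * B by rewrite -mulrDl pqE.
  case: e1 => -> ; rewrite -pqE in e0 Bb *; lra.
have P0 : pam_taylor V n.+1 0 x = 1.
  rewrite /pam_taylor big_ord_recl big1/=; last first.
    by move=> i _; rewrite /bump/= expr0n mul0r mul0r.
  by rewrite expr0 fact0 divr1 mulr1 addr0.
have key (e : R) : e = 1 \/ e = -1 ->
    0 <= (L * t) ^+ n.+1 / n.+1`!%:R + e * (v t x - pam_taylor V n.+1 t x).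
  move=> e1; have gd := diff_on_posD xn (diff_on_posZ e rd).
  have /= := ge0_derive_ndecr gd (lexx 0) t0.
  rewrite v_init P0 mulr0 expr0n/= mul0r => H.
  rewrite (_ : v t x - _ = v t x + -1 * pam_taylor V n.+1 t x); last by ring.
  apply: (le_trans _ (H _)); first by lra.
  by move=> s s0 _; apply: bound => //; exact: ltW.
apply/ler_normlP; split.
  by have := key 1 (or_introl erefl); lra.
by have := key (-1) (or_intror erefl); lra.
Qed.

Lemma pam_taylor_cvg t x : 0 <= t ->
  pam_taylor V n t x @[n --> \oo] --> v t x.
Proof.
move=> t0; apply/cvgrPdist_le => e e0.
have := cvg_series_cvg_0 (is_cvg_series_exp_coeff ((kappa + kappa - b) * t)).
move=> /cvgrPdist_le/(_ e e0) H; near=> n.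
apply: (le_trans (pam_taylor_error n x t0)).
have : `|0 - exp_coeff ((kappa + kappa - b) * t) n| <= e by near: n.
by rewrite sub0r normrN; apply: le_trans; exact: ler_norm.
Unshelve. all: by end_near. Qed.

Lemma antiderivative (g dg : R -> R) : diff_on_pos g dg ->
  exists2 F : R -> R, F 0 = 0 & diff_on_pos F g.
Proof.
move=> gd; pose F t := (\int[@lebesgue_measure R]_(s in `[0, t]) g s)%R.
have gi (t : R) : 0 < t ->
    (@lebesgue_measure R).-integrable `[0, t] (EFin \o g).
  move=> t0; apply: continuous_compact_integrable; first exact: segment_compact.
  exact: diff_on_pos_within gd (lexx 0) t0.
have F0 : F 0 = 0 by rewrite /F set_itv1 Rintegral_set1.
exists F => //; split.
  have /(continuous_within_itvP _ ltr01)[_ + _] :=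
    parameterized_integral_continuous ler01 (gi _ ltr01).
  by rewrite /parameterized_integral.
move=> t t0; have t1 : t < t + 1 by rewrite ltrDl.
have [] := continuous_FTC1_closed t1 (gi _ (lt_trans t0 t1)) t0
  (diff_on_pos_cts gd t0).
move=> dF Fg; apply: DeriveDef; first exact: dF.
by rewrite -derive1E; exact: Fg.
Qed.

(** By [pam_neighbour] a bound moves one site to the right at the price of one unit of time; the
    exponential rate is kept and only the constant grows, geometrically. *)
Lemma pam_le_exp (be C : R) : (forall t, 0 <= t -> v t 0 <= C * expR (be * t)) ->
  exists2 K : R, 1 <= K & forall (n : nat) t, 0 <= t ->
    v t n%:Z <= C * K ^+ n * expR (be * t).
Proof.
move=> vC; have C1 : 1 <= C.
  by have := vC 0 (lexx 0); rewrite v_init mulr0 expR0 mulr1.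
pose e := p * expR (- (kappa - b)); have e0 : 0 < e by rewrite mulr_gt0 ?expR_gt0.
pose K := Num.max 1 (expR be / e); have K1 : 1 <= K by rewrite le_max lexx.
exists K => //; elim=> [|n IH] t t0; first by rewrite mulr1; exact: vC.
have t1 : 0 <= t + 1 by rewrite addr_ge0.
have : v t n.+1%:Z <= e^-1 * v (t + 1) n%:Z.
  rewrite -(ler_pM2l e0) mulrA divff ?gt_eqF// mul1r.
  by have := pam_neighbour n%:Z t0; rewrite -/e intS addrC.
move=> /le_trans; apply.
have ei : 0 <= e^-1 by rewrite invr_ge0 ltW.
apply: (le_trans (ler_wpM2l ei (IH _ t1))).
rewrite (_ : be * (t + 1) = be + be * t); last by ring.
rewrite expRD exprSr !mulrA ler_pM2r ?expR_gt0//.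
rewrite (_ : e^-1 * C * K ^+ n * expR be = C * K ^+ n * (expR be / e)); last by ring.
rewrite ler_pM2l; first by rewrite /K le_max lexx orbT.
by rewrite mulr_gt0 ?(lt_le_trans _ C1)// exprn_gt0// (lt_le_trans _ K1).
Qed.

(* [U i] is the integral of [exp (- be s) * v s i] over [0, S] for large [S]. *)
Lemma pam_laplace (be be' C : R) : be' < be ->
  (forall t, 0 <= t -> v t 0 <= C * expR (be' * t)) ->
  exists B, exists2 c : R, 0 < c & forall n, exists U : nat -> R,
    [/\ U 1 <= B, forall i, c <= U i & forall i, (i < n)%N ->
      p * U i.+2 + q * U i <= (kappa + be - V i.+1) * U i.+1].
Proof.
move=> bb vC; have [K K1 vK] := pam_le_exp vC.
have C1 : 1 <= C.
  by have := vC 0 (lexx 0); rewrite v_init mulr0 expR0 mulr1.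
have d0 : 0 < be - be' by rewrite subr_gt0.
have gd x := diff_on_posM (diff_on_pos_exp (- be)) (v_diff x).
have /choice[F FE] : forall x, exists F : R -> R, F 0 = 0 /\
    diff_on_pos F (fun t => expR (- be * t) * v t x).
  by move=> x; have [F] := antiderivative (gd x); exists F.
have F0 x : F x 0 = 0 by have [] := FE x.
have Fd x : diff_on_pos (F x) (fun t => expR (- be * t) * v t x).
  by have [] := FE x.
have Fnd x s t : 0 <= s -> s <= t -> F x s <= F x t.
  move=> s0 st; apply: (ge0_derive_ndecr (Fd x)) => // r sr _.
  by rewrite mulr_ge0 ?expR_ge0// v_ge0// (le_trans s0)// ltW.
pose m := expR (- `|be + (kappa - b)|); have m0 : 0 < m by exact: expR_gt0.
have Fm x : m <= F x 1.
  have := ge0_derive_ndecr (diff_on_posD (Fd x)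
    (diff_on_posZ (- m) (diff_on_pos_id R))) (lexx 0) ler01.
  rewrite F0 mulr0 addr0 mulr1 subr_ge0; apply => s s0 s1.
  rewrite /= subr_ge0.
  have := ler_wpM2l (expR_ge0 (- be * s)) (pam_gt x (ltW s0)).
  apply: le_trans; rewrite -expRD ler_expR.
  rewrite (_ : - be * s + - (kappa - b) * s = - ((be + (kappa - b)) * s)); last by ring.
  rewrite lerN2; apply: (le_trans (ler_norm _)).
  by rewrite normrM (gtr0_norm s0) ler_piMr// ltW.
exists (C * K / (be - be')), m => // n.
(* This horizon makes [expR (- be * T) * v T i] at most 1 at the sites 1 to [n], so that the
   boundary term at [T] does not exceed the initial value 1. *)
pose T := 1 + C * K ^+ n / (be - be').
have CK : 0 <= C * K ^+ n.
  by rewrite mulr_ge0// ?exprn_ge0// (le_trans ler01).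
have T1 : 1 <= T by rewrite lerDl divr_ge0// ltW.
have T0 : 0 <= T by exact: le_trans T1.
exists (fun i => F i%:Z T); split.
- have := ge0_derive_ndecr (diff_on_posD (diff_on_posZ (- (C * K / (be - be')))
    (diff_on_pos_exp (- (be - be')))) (diff_on_posZ (-1) (Fd 1))) (lexx 0) T0.
  rewrite F0 mulr0 expR0 => H.
  have {H} := H _; set X := C * K / _; set E := expR _ => H.
  have XE : 0 <= X * E.
    rewrite mulr_ge0 ?expR_ge0// divr_ge0 ?(ltW d0)// mulr_ge0//; exact: le_trans ler01 _.
  apply: (@le_trans _ _ (X - X * E)); last by lra.
  suff : - X * 1 + -1 * 0 <= - X * E + -1 * F 1 T by lra.
  apply: H => s s0 _; have := vK 1%N s (ltW s0); rewrite expr1 => h1.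
  have := ler_wpM2l (expR_ge0 (- be * s)) h1.
  rewrite mulrCA -expRD (_ : - be * s + be' * s = - (be - be') * s); last by ring.
  have -> : - X * (- (be - be') * expR (- (be - be') * s)) =
      C * K * expR (- (be - be') * s).
    by rewrite /X; field; rewrite gt_eqF.
  rewrite mulN1r subr_ge0; lra.
- by move=> i; apply: (le_trans (Fm i)); exact: Fnd.
(* Integrating the equation over [[0, T]] shows that the slack in the supersolution inequality is
   [1 - expR (- be * T) * v T i.+1]. *)
- move=> i ni; have := ge0_derive_ndecr (diff_on_posD (diff_on_posD
    (diff_on_posZ (kappa + be - V i.+1) (Fd i.+1)) (diff_on_posD
      (diff_on_posZ (- p) (Fd (i.+1%:Z + 1)))
      (diff_on_posZ (- q) (Fd (i.+1%:Z - 1))))) (gd i.+1)) (lexx 0) T0.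
  rewrite !F0 v_init (mulr0 (- be)) expR0 => H; have {H} := H _.
  have -> : i.+1%:Z + 1 = i.+2%:Z by rewrite [RHS]intS addrC.
  have -> : i.+1%:Z - 1 = i%:Z by rewrite intS addrC addKr.
  move=> H; have {H}h1 := H _.
  have h2 : expR (- be * T) * v T i.+1 <= 1.
    apply: (le_trans (ler_wpM2l (expR_ge0 _) (vK _ _ T0))).
    rewrite mulrCA -expRD (_ : - be * T + be' * T = - ((be - be') * T)); last by ring.
    rewrite expRN ler_pdivrMr ?expR_gt0// mul1r.
    apply: le_trans (expR_ge1Dx _); rewrite /T mulrDr mulr1 [X in _ + (_ + X)]mulrC.
    rewrite divfK ?gt_eqF//.
    have : C * K ^+ i.+1 <= C * K ^+ n.
      by rewrite ler_pM2l ?(lt_le_trans ltr01)// ler_weXn2l.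
    lra.
  suff : 0 <= (kappa + be - V i.+1) * F i.+1 T - p * F i.+2 T - q * F i T by lra.
  have h3 : (kappa + be - V i.+1) * 0 + (- p * 0 + - q * 0) + 1 * 1 <=
     (kappa + be - V i.+1) * F i.+1 T + (- p * F i.+2 T + - q * F i T) +
     expR (- be * T) * v T i.+1.
    by apply: h1 => s s0 sT; lra.
  by lra.
Qed.

(* [f x] is the supremum of [exp (- be s) * v s x] over [0, t]. *)
Lemma pam_subsolution (be t : R) : 0 <= t -> 0 < kappa + be ->
  exists f : int -> R, [/\ forall x, 0 <= f x <= expR (`|be| * t),
    v t 0 <= expR (be * t) * f 0 &
    forall x, (kappa + be - V x) * f x <=
      p * f (x + 1) + q * f (x - 1) + (kappa + be - b)].
Proof.
move=> t0 kb0; pose y x s := expR (- be * s) * v s x.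
pose f x := sup [set y x s | s in `[0, t]].
pose M := expR (`|be| * t).
have yM x s : 0 <= s -> s <= t -> y x s <= M.
  move=> s0 st; rewrite -[M]mulr1; apply: ler_pM; rewrite ?expR_ge0 ?v_ge0 ?pam_le1//.
  rewrite ler_expR; apply: (le_trans (ler_norm _)).
  by rewrite normrM normrN (ger0_norm s0) ler_wpM2l.
have yub x : has_ubound [set y x s | s in `[0, t]].
  exists M => _ [s /= + <-]; rewrite in_itv/= => /andP[s0 st]; exact: yM.
have yf x s : 0 <= s -> s <= t -> y x s <= f x.
  by move=> s0 st; apply: ub_le_sup => //; exists s => //=; rewrite in_itv/= s0.
have fle x B : (forall s, 0 <= s -> s <= t -> y x s <= B) -> f x <= B.
  move=> yB; apply: ge_sup; first by exists (y x 0), 0 => //=; rewrite in_itv/= lexx.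
  by move=> _ [s /= + <-]; rewrite in_itv/= => /andP[s0 st]; exact: yB.
have f0 x : 0 <= f x.
  by apply: le_trans (yf x 0 (lexx 0) t0); rewrite mulr_ge0 ?expR_ge0 ?v_ge0.
exists f; split.
- by move=> x; rewrite f0/= fle// => s s0 st; exact: yM.
- apply: le_trans (ler_wpM2l (expR_ge0 _) (yf 0 t t0 (lexx t))).
  by rewrite /y mulrA -expRD mulNr addrN expR0 mul1r.
- move=> x; have /andP[bV V0] := V_itv x.
  set a := kappa + be - V x; set D := p * f (x + 1) + q * f (x - 1).
  have a_gt0 : 0 < a by rewrite /a; lra.
  have D0 : 0 <= D by rewrite addr_ge0// mulr_ge0// ltW.
  (* On [[0, t]] the derivative of [y x] is at most [D - a * y x] and [y x 0 = 1], so [y x] stays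
     below [D / a + 1]. Multiplying by [a] leaves an error [a <= kappa + be - b]. *)
  suff : f x <= D / a + 1.
    rewrite -(ler_pM2l a_gt0) => /le_trans; apply.
    by rewrite mulrDr mulrCA divff ?gt_eqF// !mulr1 lerD2l /a; lra.
  apply: fle => s s0 st.
  have gd := diff_on_posD (diff_on_pos_cst (D / a))
    (diff_on_posZ (-1) (diff_on_posM (diff_on_pos_exp (- be)) (v_diff x))).
  have /= := gronwall_ge (c := - a) gd (lexx 0) s0.
  rewrite v_init mulr0 expR0 subr0 => H; have {H} := H _.
  move=> H.
  have : expR (- a * s) * (D / a + -1 * (1 * 1)) <=
      D / a + -1 * (expR (- be * s) * v s x).
    apply: H => r r0 rs; have rt := ltW (lt_le_trans rs st).
    have k1 := ler_wpM2l (ltW p_gt0) (yf (x + 1) r (ltW r0) rt).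
    have k2 := ler_wpM2l q_ge0 (yf (x - 1) r (ltW r0) rt).
    have aD : a * (D / a) = D by rewrite mulrCA divff ?mulr1 ?gt_eqF.
    rewrite mulrDr mulNr aD; rewrite /y in k1 k2; rewrite /D /a; lra.
  have E1 : expR (- a * s) <= 1 by rewrite -expR0 ler_expR mulNr oppr_le0 mulr_ge0// ltW.
  have : 0 <= expR (- a * s) * (D / a) by rewrite mulr_ge0 ?expR_ge0// divr_ge0// ltW.
  rewrite /y; lra.
Qed.

End pam.

(** * Comparison for the elliptic equation *)

Section elliptic.
Context {R : realType}.
Variables (p q a0 : R).
Hypotheses (p_gt0 : 0 < p) (q_ge0 : 0 <= q) (qp : q < p) (a0_gt0 : 0 < a0).
Hypothesis a0_pq : 4 * p * q < a0 ^+ 2.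

Let rm := ratio_max p a0.
Let rstep := ratio_step p q.
Let rprod := ratio_prod p q.

(** An inequality [r * U k.+1 <= U k] propagates to the right: the supersolution inequality at the
    next site turns [r] into [rstep (a k.+1) r]. The start [r = 0] only asks that [U 0] be
    nonnegative. *)
Lemma supersolution_prod (n : nat) (a U : nat -> R) :
  (forall i, a0 <= a i) -> (forall i, 0 <= U i) ->
  (forall i, (i < n)%N -> p * U i.+2 + q * U i <= a i.+1 * U i.+1) ->
  rprod 0 [seq a i | i <- iota 1 n] * U n.+1 <= U 1.
Proof.
move=> aa U0 super.
suff H m k r : (k + m <= n)%N -> r <= rm -> r * U k.+1 <= U k ->
    rprod r [seq a i | i <- iota k.+1 m] * U (k + m).+1 <= U k.+1.
  by apply: (H n 0%N 0) => //; rewrite ?mul0r// ltW// ratio_max_gt0.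
elim: m k r => [|m IH] k r; first by rewrite addn0 mul1r.
rewrite addnS => kmn r_le rU; rewrite /=.
have kn : (k < n)%N by apply: leq_ltn_trans kmn; rewrite leq_addr.
have step : rstep (a k.+1) r * U k.+2 <= U k.+1.
  rewrite /rstep /ratio_step mulrAC ler_pdivrMr; last exact: (ratio_den_gt0 q_ge0 a0_gt0 a0_pq).
  have := super _ kn; have := ler_wpM2l q_ge0 rU; lra.
have s0 : 0 <= rstep (a k.+1) r by exact/ltW/(ratio_step_gt0 p_gt0 q_ge0 a0_gt0 a0_pq).
have := IH k.+1 (rstep (a k.+1) r).
rewrite addSn => /(_ kmn (ratio_step_le_max p_gt0 q_ge0 a0_gt0 a0_pq (aa _) r_le) step) h.
by rewrite -mulrA; apply: le_trans (ler_wpM2l s0 h) step.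
Qed.

(** An inequality [f (x - 1) <= r * f x + e] propagates to the right, with [e] becoming
    [2 / a0 * (q * e + C)]. A first pass from far left removes [M] from the error; a second one from
    site 0 collects the products. The constant [c] is uniform in the coefficients and in [M]. *)
Lemma subsolution_prod (C : R) : 0 <= C ->
  exists2 c : R, 0 < c & forall (a f : int -> R) (M : R),
  (forall x, a0 <= a x) -> (forall x, 0 <= f x <= M) ->
  (forall x, a x * f x <= p * f (x + 1) + q * f (x - 1) + C) ->
  f 0 <= rm * f 1 + c /\ forall N,
  f 1 <= c * (\sum_(n < N) rprod rm [seq a i%:Z | i <- iota 1 n])
       + rprod rm [seq a i%:Z | i <- iota 1 N] * M.
Proof.
move=> C0.
have a0q : 2 * q < a0.
  rewrite -(@ltr_pXn2r _ 2)// ?nnegrE ?mulr_ge0// ?ltW//.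
  apply: le_lt_trans a0_pq; rewrite expr2.
  have := ler_wpM2r q_ge0 (ltW qp); lra.
have d0 : 0 < a0 - 2 * q by rewrite subr_gt0.
(* The fixed point of the error recursion [e |-> 2 / a0 * (q * e + C)]. *)
pose c0 := 2 * C / (a0 - 2 * q); pose c := c0 + 1.
have c00 : 0 <= c0 by rewrite divr_ge0 ?mulr_ge0// ltW.
have cE : a0 * c0 = 2 * C + 2 * q * c0.
  by rewrite /c0; field; rewrite gt_eqF.
have rm0 : 0 < rm by exact: ratio_max_gt0.
exists c => [|a f M aa fM sub]; first by rewrite ltr_wpDl.
have f0 x : 0 <= f x by have /andP[] := fM x.
have M0 : 0 <= M by have /andP[] := fM 0; exact: le_trans.
pose rho := 2 * q / a0.
have rho0 : 0 <= rho by rewrite divr_ge0 ?mulr_ge0// ltW.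
have rho1 : rho < 1 by rewrite ltr_pdivrMr// mul1r.
have step x r e : 0 <= r -> r <= rm -> 0 <= e -> f (x - 1) <= r * f x + e ->
    f x <= rstep (a x) r * f (x + 1) + 2 / a0 * (q * e + C).
  move=> r0 r_le e0 fx.
  have den := ratio_den_gt0 q_ge0 a0_gt0 a0_pq (aa x) r_le.
  have den2 := ratio_den_ge q_ge0 a0_gt0 a0_pq (aa x) r_le.
  have k1 := ler_wpM2l q_ge0 fx; have k2 := sub x.
  have k3 : 0 <= q * e + C by rewrite addr_ge0// mulr_ge0.
  have : f x <= (p * f (x + 1) + (q * e + C)) / (a x - q * r).
    rewrite ler_pdivlMr//; lra.
  move=> /le_trans; apply; rewrite mulrDl lerD//.
    by rewrite /rstep /ratio_step mulrAC.
  rewrite mulrC ler_wpM2r// -(invf_div a0 2) lef_pV2 ?posrE ?divr_gt0//.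
(* The trivial bound [f <= M] is used [n] sites to the left of [x] and damped by [rho < 1] at each
   site. *)
have weak n x : f x <= rm * f (x + 1) + (c0 + rho ^+ n * M).
  elim: n x => [|n IH] x.
    have /andP[_ fxM] := fM x; rewrite expr0 mul1r.
    by rewrite addrA ler_wpDl// addr_ge0// mulr_ge0// ltW.
  have e0 : 0 <= c0 + rho ^+ n * M by rewrite addr_ge0// mulr_ge0// exprn_ge0.
  have h1 := IH (x - 1); rewrite subrK in h1.
  apply: (le_trans (step _ _ _ (ltW rm0) (lexx _) e0 h1)).
  apply: lerD.
    by rewrite ler_wpM2r// (ratio_step_le_max p_gt0 q_ge0 a0_gt0 a0_pq).
  rewrite exprS -(ler_pM2l a0_gt0) [leRHS]mulrDr cE.
  rewrite le_eqVlt; apply/orP; left; apply/eqP; rewrite /rho; field.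
  by rewrite gt_eqF.
have strong x : f x <= rm * f (x + 1) + c0.
  have cv : rm * f (x + 1) + (c0 + rho ^+ n * M) @[n --> \oo] -->
      rm * f (x + 1) + (c0 + 0 * M).
    apply: cvgD; first exact: cvg_cst.
    apply: cvgD; first exact: cvg_cst.
    by apply: cvgMl; apply: cvg_expr; rewrite ger0_norm.
  by have := ge_cvgn cv (fun n => weak n x); rewrite mul0r addr0.
split; first by apply: (le_trans (strong 0)); rewrite add0r /c lerD2l lerDl.
suff H N k r : 0 <= r -> r <= rm -> f k%:Z <= r * f k.+1%:Z + c0 ->
    f k.+1%:Z <= c0 * (\sum_(n < N) rprod r [seq a i%:Z | i <- iota k.+1 n])
       + rprod r [seq a i%:Z | i <- iota k.+1 N] * M.
  move=> N; apply: (le_trans (H N 0%N rm (ltW rm0) (lexx _) (strong 0))).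
  rewrite lerD2r ler_wpM2r// ?lerDl//; apply: sumr_ge0 => n _.
  apply/ltW/(ratio_prod_gt0 p_gt0 q_ge0 a0_gt0 a0_pq) => //.
  by apply/allP => _ /mapP[i _ ->].
elim: N k r => [|N IH] k r r0 r_le fk.
  by rewrite big_ord0 mulr0 add0r mul1r; have /andP[] := fM k.+1.
have s0 : 0 <= rstep (a k.+1) r by exact/ltW/(ratio_step_gt0 p_gt0 q_ge0 a0_gt0 a0_pq).
have f1 : f k.+1%:Z <= rstep (a k.+1) r * f k.+2%:Z + c0.
  have e1 : k.+1%:Z - 1 = k%:Z by rewrite intS addrC addKr.
  have e2 : k.+1%:Z + 1 = k.+2%:Z by rewrite [RHS]intS addrC.
  have := step k.+1 r c0 r0 r_le c00; rewrite e1 e2 => /(_ fk) /le_trans; apply.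
  rewrite lerD2l -(ler_pM2l a0_gt0) cE mulrA mulrCA divff ?gt_eqF// mulr1; lra.
have := IH k.+1 _ s0 (ratio_step_le_max p_gt0 q_ge0 a0_gt0 a0_pq (aa _) r_le) f1.
move=> /(ler_wpM2l s0) h.
rewrite big_ord_recl/= mulrDr mulr1 -/rprod.
apply: (le_trans f1); rewrite addrC -addrA lerD2l.
apply: (le_trans h); rewrite mulrDr mulrA lerD//.
  by rewrite -mulr_sumr [leRHS]mulrA [X in _ <= X * _](mulrC c0); exact: lexx.
by rewrite mulrA.
Qed.

End elliptic.

(* Each step decreases [p * U i.+1 / U i] by at least [2 sqrt(p q) - g]. *)
Lemma no_long_run (R : realType) (p q g : R) : 0 < p -> 0 <= q ->
  g < 2 * Num.sqrt (p * q) ->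
  exists n, forall U : nat -> R, (forall i, 0 < U i) ->
  ~ forall i, (i < n)%N -> p * U i.+2 + q * U i <= g * U i.+1.
Proof.
move=> p0 q0 gs; set s := Num.sqrt (p * q) in gs.
have s2 : s ^+ 2 = p * q by rewrite sqr_sqrtr// mulr_ge0// ltW.
pose eta := 2 * s - g; have eta0 : 0 < eta by rewrite subr_gt0.
have [n gn] : exists n : nat, g < n%:R * eta.
  exists (Num.truncn (`|g| / eta)).+1; rewrite -ltr_pdivrMr//.
  apply: le_lt_trans (Num.Theory.truncnS_gt _); rewrite ler_pM2r ?invr_gt0//; exact: ler_norm.
exists n.+1 => U U0 run.
have step i : (i <= n)%N -> p * U i.+2 <= (g - i%:R * eta) * U i.+1.
  elim: i => [|i IH] ni.
    by have := run 0%N isT; have := mulr_ge0 q0 (ltW (U0 0%N)); lra.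
  have {}IH := IH (ltnW ni); have r := run i.+1 ni.
  rewrite -(ler_pM2l (U0 i.+1)) -subr_ge0.
  rewrite -natr1.
  (* With [x = p * U i.+2 / U i.+1] this is [x + p * q / x >= 2 * s], cleared of denominators. *)
  have sq := sqr_ge0 (p * U i.+2 - s * U i.+1).
  have k1 := ler_wpM2r (ltW (U0 i.+2)) IH.
  have k2 := ler_wpM2l (ltW (U0 i.+1)) r.
  rewrite -(pmulr_rge0 _ p0).
  have pq : p * q * (U i.+1 * U i.+1) = s * s * (U i.+1 * U i.+1) by rewrite -[s * s]expr2 s2.
  have k3 := ler_wpM2l (ltW p0) k1; have k4 := ler_wpM2l (ltW p0) k2.
  rewrite expr2 in sq; rewrite /eta in k3 *; lra.
have := step n (leqnn n); have := mulr_gt0 p0 (U0 n.+2).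
move=> h1 /(lt_le_trans h1); rewrite pmulr_lgt0//; lra.
Qed.

(** * Expectations over independent sites *)

Section product_expectation.
Context {R : realType} {I : finType}.
Variable pi : I -> R.
Hypotheses (pi_ge0 : forall j, 0 <= pi j) (pi_sum : \sum_j pi j = 1).

(** The expectation over words of [n] independent letters of law [pi], as an iterated finite sum. *)
Fixpoint pexp (n : nat) (f : seq I -> R) : R :=
  if n is m.+1 then \sum_j pi j * pexp m (fun v => f (j :: v)) else f [::].

Lemma pexp_le n (f g : seq I -> R) :
  (forall v, size v = n -> f v <= g v) -> pexp n f <= pexp n g.
Proof.
elim: n f g => [|n IH] f g fg /=; first exact: fg.
apply: ler_sum => j _; rewrite ler_wpM2l// IH// => v vn.
by apply: fg; rewrite /= vn.
Qed.

Lemma eq_pexp n (f g : seq I -> R) :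
  (forall v, size v = n -> f v = g v) -> pexp n f = pexp n g.
Proof.
by move=> fg; apply/eqP; rewrite eq_le !pexp_le// => v /fg ->.
Qed.

Lemma pexpD n (f g : seq I -> R) :
  pexp n (fun v => f v + g v) = pexp n f + pexp n g.
Proof.
elim: n f g => [//|n IH] f g /=; rewrite -big_split/=.
by apply: eq_bigr => j _; rewrite IH mulrDr.
Qed.

Lemma pexp_sum n m (F : 'I_m -> seq I -> R) :
  pexp n (fun v => \sum_(i < m) F i v) = \sum_(i < m) pexp n (F i).
Proof.
elim: n F => [//|n IH] F /=; rewrite exchange_big; apply: eq_bigr => j _ /=.
by rewrite (IH (fun i v => F i (j :: v))) mulr_sumr.
Qed.

Lemma pexpZ n c (f : seq I -> R) : pexp n (fun v => c * f v) = c * pexp n f.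
Proof.
elim: n f => [//|n IH] f /=; rewrite mulr_sumr.
by apply: eq_bigr => j _; rewrite IH mulrCA.
Qed.

Lemma pexp_cst n (c : R) : pexp n (fun=> c) = c.
Proof.
elim: n => [//|n IH] /=.
under eq_bigr do rewrite IH.
by rewrite -mulr_suml pi_sum mul1r.
Qed.

Lemma pexp_ge0 n (f : seq I -> R) : (forall v, size v = n -> 0 <= f v) ->
  0 <= pexp n f.
Proof. by move=> f0; rewrite -(pexp_cst n 0); exact: pexp_le. Qed.

Lemma pexp_cat m n (f : seq I -> R) :
  pexp (m + n) f = pexp m (fun v => pexp n (fun w => f (v ++ w))).
Proof.
elim: m f => [//|m IH] f; rewrite addSn /=.
by apply: eq_bigr => j _; rewrite IH.
Qed.

Lemma pexp_cat_le m n (f : seq I -> R) : (forall v, 0 <= f v) ->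
  (forall v w, f (v ++ w) <= f v * f w) ->
  pexp (m + n) f <= pexp m f * pexp n f.
Proof.
move=> f0 fcat; rewrite pexp_cat mulrC -pexpZ.
apply: pexp_le => v _; rewrite mulrC -pexpZ; exact: pexp_le.
Qed.

(** The bound [expR x <= 1 + x * expR x] is used twice for [y >= 0]; for [y < 0] its second use is
    replaced by [expR y >= 1 + y]. *)
Lemma expR_le_quad (y : R) : expR y <= 1 + y + y ^+ 2 * expR `|y|.
Proof.
have lin (x : R) : expR x <= 1 + x * expR x.
  have := expR_ge1Dx (- x); rewrite expRN -(ler_pM2r (expR_gt0 x)).
  by rewrite mulVf ?gt_eqF ?expR_gt0// mulrDl mul1r mulNr lerBlDr.
apply: (le_trans (lin y)); rewrite -addrA lerD2l expr2.
have [y0|y0] := leP 0 y.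
  rewrite (ger0_norm y0); have := ler_wpM2l y0 (lin y); lra.
have h1 := ler_wnM2l (ltW y0) (expR_ge1Dx y).
have : y * y <= y * y * expR `|y|.
  rewrite ler_peMr//; first by rewrite -expr2 sqr_ge0.
  by rewrite -expR0 ler_expR normr_ge0.
lra.
Qed.

(* The derivative at [s = 0] of the left-hand side is [pexp n f]. *)
Lemma pexp_exp_lt1 n (f : seq I -> R) : pexp n f < 0 ->
  exists2 s0 : R, 0 < s0 &
    forall s, 0 < s -> s < s0 -> pexp n (fun v => expR (s * f v)) < 1.
Proof.
move=> fn; pose Q := pexp n (fun v => f v ^+ 2 * expR `|f v|).
have Q0 : 0 <= Q by apply: pexp_ge0 => v _; rewrite mulr_ge0 ?sqr_ge0 ?expR_ge0.
have Q1 : 0 < Q + 1 by rewrite ltr_wpDl.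
(* The cap 1 bounds the quadratic remainder by [s ^+ 2 * Q]; the other term makes this smaller than
   the linear gain. *)
exists (Num.min 1 (- pexp n f / (Q + 1))).
  by rewrite lt_min ltr01/= divr_gt0// oppr_gt0.
move=> s s0; rewrite lt_min => /andP[s1]; rewrite ltr_pdivlMr// => sQ.
have : pexp n (fun v => expR (s * f v)) <= 1 + s * pexp n f + s ^+ 2 * Q.
  rewrite -[1](pexp_cst n) -!pexpZ -!pexpD; apply: pexp_le => v _.
  apply: (le_trans (expR_le_quad _)); rewrite lerD2l exprMn -mulrA.
  rewrite ler_wpM2l ?sqr_ge0// ler_wpM2l ?sqr_ge0// ler_expR.
  by rewrite normrM (gtr0_norm s0) ler_piMl// ltW.
move=> /le_lt_trans; apply.
have : s * (s * (Q + 1)) < s * - pexp n f by rewrite ltr_pM2l.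
have := mulr_gt0 s0 s0; rewrite expr2; lra.
Qed.

End product_expectation.

(** Each block of length [m] contributes a factor [e m < 1], whence geometric decay along the
    multiples of [m]. The second conclusion serves to drop a boundary term [D * e N]. *)
Lemma submul_sum_bound (R : realType) (e : nat -> R) (m : nat) :
  (forall n, 0 <= e n) -> e 0%N = 1 ->
  (forall i j, e (i + j)%N <= e i * e j) -> e m < 1 ->
  (exists B : R, forall N, \sum_(n < N) e n <= B) /\
  (forall D, 0 <= D -> forall x, (forall N, x <= D * e N) -> x <= 0).
Proof.
move=> e0 e01 esub em.
have m0 : (0 < m)%N by case: m em => //; rewrite e01 ltxx.
pose B := \sum_(n < m) e n; have B0 : 0 <= B by exact: sumr_ge0.
have em1 : 0 < 1 - e m by rewrite subr_gt0.
split.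
  exists (B / (1 - e m)) => N; apply: (@le_trans _ _ (\sum_(n < (N * m)%N) e n)).
    have NNm : (N <= N * m)%N by rewrite leq_pmulr.
    rewrite -!(big_mkord xpredT e) [leRHS](big_cat_nat (leq0n N) NNm)/= lerDl; exact: sumr_ge0.
  elim: N => [|N IH]; first by rewrite mul0n big_ord0 divr_ge0// ltW.
  rewrite mulSn big_split_ord/= -/B.
  have : \sum_(i < N * m) e (m + i)%N <= e m * \sum_(i < N * m) e i.
    by rewrite mulr_sumr; apply: ler_sum => i _.
  have := ler_wpM2l (e0 m) IH.
  have : B / (1 - e m) * (1 - e m) = B by rewrite divfK ?gt_eqF.
  lra.
move=> D D0 x xD.
have ek k : e (k * m)%N <= e m ^+ k.
  elim: k => [|k IH]; first by rewrite mul0n e01.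
  by rewrite mulSn exprS (le_trans (esub _ _))// ler_wpM2l.
have cv : D * e m ^+ k @[k --> \oo] --> D * 0.
  by apply: cvgMr; apply: cvg_expr; rewrite ger0_norm.
rewrite -(mulr0 D); apply: (ge_cvgn cv) => k.
by apply: (le_trans (xD (k * m)%N)); rewrite ler_wpM2l.
Qed.

Section nonmeasurable.
Import HBNNSimple.

(* Unlike [ae_ge0_le_integral], no measurability is required. *)
Lemma ge0_ae_le_integral_gen (d : measure_display) (T : measurableType d)
    (R : realType) (mu : {measure set T -> \bar R}) (f g : T -> \bar R) :
  (forall x, 0 <= f x)%E -> (forall x, 0 <= g x)%E ->
  {ae mu, forall x, f x <= g x}%E -> (\int[mu]_x f x <= \int[mu]_x g x)%E.
Proof.
move=> f0 g0 [N [mN N0 subN]].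
rewrite [leLHS]ge0_integralTE// [leRHS]ge0_integralTE//.
apply: ge_ereal_sup => _ [h hf <-].
have mNC : measurable (~` N) by exact: measurableC.
(* Cutting [h] off the null set keeps its integral and puts it below [g] everywhere. *)
pose h' := proj_nnsfun h mNC.
have h'g x : ((h' x)%:E <= g x)%E.
  rewrite /= mindicE. have [xN|xN] := boolP (x \in ~` N).
    rewrite mulr1; apply: (le_trans (hf x)); apply: contrapT => fg.
    by move: xN; rewrite inE; apply; exact: subN.
  by rewrite mulr0.
apply: ereal_sup_ubound; exists h' => //.
rewrite -!integralT_nnsfun; apply: ge0_ae_eq_integral => //=.
- by apply/measurable_EFinP; apply: measurable_funM => //; exact: measurable_indic.
- by apply/measurable_EFinP.
- by move=> x _; rewrite lee_fin (@fun_ge0 _ _ h').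
- by move=> x _; rewrite lee_fin fun_ge0.
exists N; split => // x /= /not_implyP[_ hx]; apply: contrapT => xN; apply: hx.
by rewrite mindicE mem_set// mulr1.
Qed.

End nonmeasurable.

(** * Words read along the environment *)

Section link.
Context d (T : measurableType d) (R : realType) (P : probability T R).
Context {I : finType}.
Variables (pi : I -> R) (J : nat -> T -> I).
Hypotheses (pi_ge0 : forall j, 0 <= pi j) (pi_sum : \sum_j pi j = 1).

Definition env_path (n : nat) (w : T) : seq I := [seq J i w | i <- iota 1 n].

Hypothesis path_meas : forall v, measurable [set w | env_path (size v) w = v].
Hypothesis path_law : forall v,
  P [set w | env_path (size v) w = v] = (\prod_(j <- v) pi j)%:E.

Let size_path n w : size (env_path n w) = n.
Proof. by rewrite size_map size_iota. Qed.

(* [seqsum n f] sums [f] over all sequences of length [n]. *)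
Fixpoint seqsum (n : nat) (f : seq I -> R) : R :=
  if n is m.+1 then \sum_j seqsum m (fun v => f (j :: v)) else f [::].

Lemma seqsum_ge0 n (f : seq I -> R) : (forall v, 0 <= f v) -> 0 <= seqsum n f.
Proof.
elim: n f => [|n IH] f f0 /=; first exact: f0.
by apply: sumr_ge0 => i _; apply: IH => v; exact: f0.
Qed.

Lemma seqsum_delta n (f : seq I -> R) s : size s = n ->
  seqsum n (fun v => f v * (v == s)%:R) = f s.
Proof.
elim: n f s => [|n IH] f [|a s]//=; first by rewrite mulr1.
move=> [sn]; rewrite (bigD1 a)//= [X in _ + X]big1 ?addr0; last first.
  move=> j ja; under [X in seqsum n X]eq_fun do rewrite eqseq_cons (negbTE ja) mulr0.
  by elim: n {IH sn} => //= n IH; rewrite big1.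
under [X in seqsum n X]eq_fun do rewrite eqseq_cons eqxx/=.
exact: (IH (fun v => f (a :: v))).
Qed.

Lemma pexpE n (f : seq I -> R) :
  pexp pi n f = seqsum n (fun v => (\prod_(j <- v) pi j) * f v).
Proof.
suff H c (g : seq I -> R) : c * pexp pi n g =
    seqsum n (fun v => c * (\prod_(j <- v) pi j) * g v).
  rewrite -[LHS]mul1r H; congr (seqsum n _).
  by apply/funext => v; rewrite mul1r.
elim: n c g => [|n IH] c g /=; first by rewrite big_nil mulr1.
rewrite mulr_sumr; apply: eq_bigr => j _; rewrite mulrA IH.
by congr (seqsum n _); apply/funext => v; rewrite big_cons mulrA.
Qed.

Lemma measurable_seqsum n (F : seq I -> T -> R) :
  (forall v, size v = n -> measurable_fun setT (F v)) ->
  measurable_fun setT (fun w => seqsum n (F ^~ w)).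
Proof.
elim: n F => [|n IH] F mF /=; first exact: mF.
apply: measurable_sum => j; apply: (IH (fun v => F (j :: v))) => v vn.
by apply: mF; rewrite /= vn.
Qed.

Lemma integral_seqsum n (F : seq I -> T -> R) (c : seq I -> R) :
  (forall v, size v = n -> measurable_fun setT (F v)) ->
  (forall v w, 0 <= F v w) ->
  (forall v, size v = n -> \int[P]_w (F v w)%:E = (c v)%:E)%E ->
  (\int[P]_w (seqsum n (F ^~ w))%:E = (seqsum n c)%:E)%E.
Proof.
elim: n F c => [|n IH] F c mF F0 Fc /=; first exact: Fc.
under eq_integral do rewrite -sumEFin.
rewrite ge0_integral_sum//=; first last.
- move=> j w _; rewrite lee_fin.
  exact: seqsum_ge0.
- move=> j; apply/measurable_EFinP.
  apply: (measurable_seqsum (F := fun v => F (j :: v))) => v vn.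
  by apply: mF; rewrite /= vn.
rewrite -sumEFin; apply: eq_bigr => j _; apply: (IH (fun v => F (j :: v))) => //.
  by move=> v vn; apply: mF; rewrite /= vn.
by move=> v vn; apply: Fc; rewrite /= vn.
Qed.

(** A function of the word is a finite combination of indicators of cylinder events, whose
    probabilities are given by [path_law]. *)
Let pathE n (f : seq I -> R) : (fun w => f (env_path n w)) =
  fun w => seqsum n (fun v => f v * \1_[set w | env_path n w = v] w).
Proof.
apply/funext => w; rewrite -[LHS](seqsum_delta f (size_path n w)).
congr (seqsum n _); apply/funext => v; rewrite indicE; congr (_ * _%:R).
congr nat_of_bool; apply/eqP/idP; first by move=> ->; rewrite inE.
by rewrite inE => ->.
Qed.

Lemma measurable_path n (f : seq I -> R) :
  measurable_fun setT (fun w => f (env_path n w)).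
Proof.
rewrite pathE; apply: measurable_seqsum => v vn.
by apply: measurable_funM => //; apply: measurable_indic; rewrite -vn.
Qed.

Lemma integral_path n (f : seq I -> R) : (forall v, 0 <= f v) ->
  (\int[P]_w (f (env_path n w))%:E = (pexp pi n f)%:E)%E.
Proof.
move=> f0; have /(congr1 (fun g : T -> R => (\int[P]_w (g w)%:E)%E)) -> := pathE n f.
rewrite pexpE.
apply: (integral_seqsum (F := fun v w => f v * \1_[set w | env_path n w = v] w)).
- move=> v vn; apply: measurable_funM => //.
  by apply: measurable_indic; rewrite -vn.
- by move=> v w; rewrite mulr_ge0.
- move=> v vn; under eq_integral do rewrite EFinM.
  have mv : measurable [set w | env_path n w = v] by rewrite -vn.
  rewrite ge0_integralZl_EFin//=; last first.
    by apply/measurable_EFinP; exact: measurable_indic.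
  by rewrite integral_indic// setIT mulrC EFinM; congr (_ * _)%E; rewrite -[RHS]path_law vn.
Qed.

(* If the additive functional [f] stays bounded along almost every path, its
   mean grows sublinearly. *)
Lemma pexp_sublinear (f : seq I -> R) (B e : R) : 0 <= B -> 0 < e ->
  (forall v, f v <= B * (size v)%:R) ->
  {ae P, forall w, exists C, forall n, f (env_path n w) <= C} ->
  \forall n \near \oo, pexp pi n f <= e * n%:R.
Proof.
move=> B0 e0 fB [N [mN N0 subN]].
(* Since [f] is controlled from above only, its positive part is averaged; it is dominated by [B]
   and tends to 0 almost surely. *)
pose g n v := Num.max 0 (f v) / n%:R.
have g0 n v : 0 <= g n v by rewrite divr_ge0// le_max lexx.
have gB n w : g n (env_path n w) <= B.
  rewrite /g; case: n => [|n]; first by rewrite invr0 mulr0.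
  rewrite ler_pdivrMr// ge_max mulr_ge0//=.
  by have := fB (env_path n.+1 w); rewrite size_path.
have : (\int[P]_w (g n (env_path n w))%:E)%E @[n --> \oo] --> (\int[P]_w (cst 0%E w))%E.
  have [] // := @dominated_convergence _ _ _ P setT measurableT
    (fun n w => (g n (env_path n w))%:E) (cst 0%E) (EFin \o cst B).
  - by move=> n; apply/measurable_EFinP; exact: (measurable_path n (g n)).
  - exists N; split => // w /= Nw; apply: subN => -[C fC]; apply: Nw => _.
    apply/fine_cvgP; split; first exact: nearW.
    apply/cvgrPdist_le => e' e'0; near=> n; rewrite sub0r normrN ger0_norm ?g0//=.
    have n0 : (0 < n)%N by near: n; exists 1%N.
    rewrite ler_pdivrMr ?ltr0n//; apply: (@le_trans _ _ `|C|).
      by rewrite ge_max normr_ge0 (le_trans (fC n))// ler_norm.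
    rewrite -ler_pdivrMl//.
    have : `|C| / e' <= n%:R by near: n; exact: nbhs_infty_ger.
    by rewrite mulrC.
  - exact: finite_measure_integrable_cst.
  - apply: aeW => w n _ /=; rewrite lee_fin ger0_norm ?g0//.
rewrite integral_cst// mul0e.
have -> : (fun n => \int[P]_w (g n (env_path n w))%:E)%E =
    (fun n => (pexp pi n (g n))%:E) by apply/funext => n; exact: integral_path.
move=> /fine_cvgP[_ /cvgrPdist_le/(_ e e0)]; apply: filterS => n.
rewrite sub0r normrN /= => h; have {}h := le_trans (ler_norm _) h.
case: n h => [|n] h.
  by rewrite mulr0; have := fB [::]; rewrite mulr0.
apply: (@le_trans _ _ (n.+1%:R * pexp pi n.+1 (g n.+1))); last first.
  by rewrite mulrC ler_wpM2r.
rewrite -pexpZ; apply: pexp_le => // v _.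
by rewrite /g mulrCA divff ?mulr1 ?pnatr_eq0// le_max lexx orbT.
Unshelve. all: by end_near. Qed.

End link.

(** For [z] equal to [x] or [y], the fraction [z / (x + y)] lies in [[0, 1]] and is at most its own
    [s]-th power; the two cases are added. *)
Lemma powR_subadd (R : realType) (s x y : R) : 0 < s -> s <= 1 ->
  0 <= x -> 0 <= y -> (x + y) `^ s <= x `^ s + y `^ s.
Proof.
move=> s0 s1 x0 y0; have [xy|xy] := eqVneq (x + y) 0.
  by rewrite xy powR0 ?gt_eqF// addr_ge0// powR_ge0.
have xy0 : 0 < x + y by rewrite lt_neqAle eq_sym xy addr_ge0.
have xyge := ltW xy0.
have part z : 0 <= z -> z <= x + y -> z / (x + y) * (x + y) `^ s <= z `^ s.
  move=> z0 zxy; have zE : z = z / (x + y) * (x + y) by rewrite divfK.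
  rewrite [in leRHS]zE powRM ?divr_ge0//.
  rewrite ler_wpM2r ?powR_ge0//.
  have := z0; rewrite le_eqVlt => /predU1P[<-|zp]; first by rewrite mul0r powR_ge0.
  by apply: ger1_powR => //; rewrite divr_gt0//= ler_pdivrMr// mul1r.
have hx := part x x0; have hy := part y y0; rewrite lerDl in hx; rewrite lerDr in hy.
apply: le_trans (lerD (hx y0) (hy x0)).
by rewrite -mulrDl -mulrDl divff// mul1r.
Qed.

Lemma powR_sum_le (R : realType) (s : R) (n : nat) (F : nat -> R) :
  0 < s -> s <= 1 -> (forall i, 0 <= F i) ->
  (\sum_(i < n) F i) `^ s <= \sum_(i < n) F i `^ s.
Proof.
move=> s0 s1 F0; elim: n => [|n IH]; first by rewrite !big_ord0 powR0 ?gt_eqF.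
rewrite !big_ord_recr/=; apply: le_trans (powR_subadd s0 s1 _ _) _ => //.
  exact: sumr_ge0.
by rewrite lerD2r.
Qed.

(** * Small moments of the ratio products *)

Section moments.
Context {R : realType} {I : finType}.
Variables (pi : I -> R) (p q a0 : R).
Hypotheses (pi_ge0 : forall j, 0 <= pi j) (pi_sum : \sum_j pi j = 1).
Hypotheses (p_gt0 : 0 < p) (q_ge0 : 0 <= q) (qp : q < p) (a0_gt0 : 0 < a0).
Hypothesis a0_pq : 4 * p * q < a0 ^+ 2.

Lemma pexp_take m n (f : seq I -> R) : (m <= n)%N ->
  pexp pi n (fun v => f (take m v)) = pexp pi m f.
Proof.
move=> mn; rewrite -(subnKC mn) pexp_cat; apply: (eq_pexp pi_ge0) => v vm.
rewrite -[RHS](pexp_cst pi_sum (n - m)); apply: (eq_pexp pi_ge0) => w _.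
by rewrite take_size_cat.
Qed.

(** By [ratio_prod_shift], raising the entries by [dl] adds the negative amount [ln th] per letter
    to the logarithm, which beats a sublinear mean. At some length [m] the mean logarithm is
    negative, so small moments are below 1 there, and submultiplicativity does the rest. *)
Lemma moment_sum_bound (a : I -> R) (A dl : R) : 0 < dl ->
  (forall j, a0 <= a j <= A) ->
  (forall e, 0 < e -> \forall n \near \oo,
    pexp pi n (fun v => ln (ratio_prod p q 0 (map a v))) <= e * n%:R) ->
  exists2 s0 : R, 0 < s0 & forall s, 0 < s -> s < s0 ->
    let e n := pexp pi n (fun v =>
      ratio_prod p q (ratio_max p a0) [seq a j + dl | j <- v] `^ s) in
    (exists B : R, forall N, \sum_(n < N) e n <= B) /\
    (forall D, 0 <= D -> forall x, (forall N, x <= D * e N) -> x <= 0).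
Proof.
move=> d0 aA low; pose rm := ratio_max p a0.
pose G v := ratio_prod p q rm [seq a j + dl | j <- v].
pose L v := ratio_prod p q 0 (map a v).
have allA v : all (fun x => a0 <= x <= A) (map a v).
  by rewrite all_map; apply/allP => j _; exact: aA.
have alla v : all (>= a0) (map a v).
  by apply: sub_all (allA v) => x /andP[].
have alld v : all (>= a0) [seq a j + dl | j <- v].
  rewrite all_map; apply/allP => j _ /=; have /andP[aj _] := aA j.
  by rewrite (le_trans aj)// lerDl ltW.
have G0 v : 0 < G v by exact: (ratio_prod_gt0 p_gt0 q_ge0 a0_gt0 a0_pq).
have rm0 : 0 <= rm by exact/ltW/ratio_max_gt0.
have L0 v : 0 < L v by exact: (ratio_prod_gt0 p_gt0 q_ge0 a0_gt0 a0_pq).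
have Gcat v w : G (v ++ w) <= G v * G w.
  by rewrite /G map_cat; exact: (ratio_prod_cat_le p_gt0 q_ge0 a0_gt0 a0_pq).
have [j0 _|I0] := pickP I; last first.
  by have := pi_sum; rewrite big_pred0// => /eqP; rewrite eq_sym oner_eq0.
have a0A : a0 <= A by have /andP[+ ?] := aA j0; move=> /le_trans; exact.
have [C [th /andP[th0 th1] [C0 GL]]] :=
  ratio_prod_shift p_gt0 q_ge0 a0_gt0 a0_pq d0 a0A.
have lnth : ln th < 0 by rewrite ln_lt0// th0.
have lnG v : ln (G v) <= ln C + (size v)%:R * ln th + ln (L v).
  have tn : 0 < th ^+ size v by exact: exprn_gt0.
  rewrite mulr_natl -lnXn// -lnM ?posrE ?exprn_gt0//.
  rewrite -lnM ?posrE ?mulr_gt0 ?exprn_gt0// ler_ln ?posrE ?mulr_gt0 ?exprn_gt0//.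
  by have := GL _ (allA v); rewrite size_map -map_comp.
have [m Gm] : exists m, pexp pi m (fun v => ln (G v)) < 0.
  have e0 : 0 < - ln th / 2 by rewrite divr_gt0// oppr_gt0.
  have : \forall n \near \oo, pexp pi n (fun v => ln (G v)) < 0.
    near=> n.
    have h1 : pexp pi n (fun v => ln (L v)) <= - ln th / 2 * n%:R.
      by near: n; exact: low.
    have h2 : pexp pi n (fun v => ln (G v)) <=
        ln C + n%:R * ln th + pexp pi n (fun v => ln (L v)).
      rewrite -[X in X + _](pexp_cst pi_sum n) -pexpD.
      by apply: (pexp_le pi_ge0) => v <-.
    have h3 : (`|ln C| + 1) / (- ln th / 2) <= n%:R by near: n; exact: nbhs_infty_ger.
    rewrite ler_pdivrMr// in h3; have := ler_norm (ln C); lra.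
  by move=> [n _ /(_ n (leqnn n))]; exists n.
have [s0 s00 Es] := pexp_exp_lt1 pi_ge0 pi_sum Gm.
exists s0 => // s sp ss0 e.
apply: (@submul_sum_bound _ e m).
- by move=> n; apply: (pexp_ge0 pi_ge0 pi_sum) => v _; exact: powR_ge0.
- by rewrite /e /= powR1.
- move=> i j; apply: (pexp_cat_le pi_ge0); first by move=> v; exact: powR_ge0.
  move=> v w; rewrite -powRM ?(ltW (G0 _))//.
  apply: ge0_ler_powR; rewrite ?nnegrE; [exact: ltW|exact/ltW/G0| |exact: Gcat].
  by apply: mulr_ge0; exact/ltW/G0.
- apply: le_lt_trans (Es s sp ss0); apply: (pexp_le pi_ge0) => v _.
  by rewrite /powR (gt_eqF (G0 v)).
Unshelve. all: by end_near. Qed.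

End moments.

(** * The random environment *)

Section level.
Context {R : realType}.
Variables (b dl : R).
Hypothesis dl_gt0 : 0 < dl.

(* [level y] rounds [- y / dl] down; it is meaningful for [b <= y <= 0] only. *)
Definition level (y : R) : 'I_(Num.truncn (- b / dl)).+1 :=
  inord (Num.truncn (Num.max 0 (- y / dl))).

Lemma levelP y : b <= y <= 0 -> (level y)%:R * dl <= - y < (level y).+1%:R * dl.
Proof.
move=> /andP[bY y0]; have yd : 0 <= - y / dl by rewrite divr_ge0 ?oppr_ge0// ltW.
rewrite /level max_r// inordK; last first.
  by rewrite ltnS le_truncn// ler_pM2r ?invr_gt0// lerN2.
by rewrite -ler_pdivlMr// -ltr_pdivrMr// truncn_itv.
Qed.

Lemma measurable_level j : measurable [set y | level y = j].
Proof.
pose z (y : R) := Num.max 0 (- y / dl).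
have mz : measurable_fun setT z.
  by apply: measurable_maxr => //; apply: measurable_funM => //; exact: measurableT_comp.
rewrite (_ : mkset _ = \bigcup_(n in [set n | inord n = j]) (z @^-1` `[n%:R, n.+1%:R[)).
  apply: bigcup_measurable => n _; rewrite -[X in measurable X]setTI.
  by apply: mz => //; exact: measurable_itv.
have z0 y : 0 <= z y by rewrite le_max lexx.
apply/seteqP; split => y /=.
  move=> yj; exists (Num.truncn (z y)) => //=.
  by rewrite in_itv/= truncn_itv.
by move=> [n /= nj]; rewrite in_itv/= => /truncn_def zn; rewrite /level -/(z y) zn.
Qed.

End level.

Section environment.
Context d (T : measurableType d) (R : realType) (P : probability T R).
Variables (b : R) (eta : probability R R) (xi : int -> {RV P >-> R}).
Hypothesis eta_supp : eta `[b, 0]%classic = 1%E.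
Hypothesis xi_indep : mutually_independent xi.
Hypothesis xi_law : forall x, has_law (xi x) eta.

Lemma xi_prob x (A : set R) : measurable A -> P (xi x @^-1` A) = eta A.
Proof. exact: xi_law. Qed.

Lemma ae_forall_int (Q : int -> T -> Prop) :
  (forall x, {ae P, forall w, Q x w}) -> {ae P, forall w, forall x, Q x w}.
Proof.
move=> Qx; have H : {ae P, forall w, forall n : nat,
    Q (odflt 0 (unpickle n)) w} by apply: ae_foralln => n; exact: Qx.
apply: filterS H => w H x; have := H (pickle x).
by rewrite pickleK.
Qed.

Lemma xi_itv : {ae P, forall w, forall x, b <= xi x w <= 0}.
Proof.
apply: ae_forall_int => x.
have mi : measurable (`[b, 0]%classic : set R) by exact: measurable_itv.
exists (xi x @^-1` (~` `[b, 0]%classic)); split.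
- by apply: measurable_funPTI; exact: measurableC.
- rewrite xi_prob; last exact: measurableC.
  by rewrite probability_setC// eta_supp subee.
- by move=> w /= h; rewrite in_itv/=.
Qed.

Let sites n : seq int := [seq i%:Z | i <- iota 1 n].

Let sites_uniq n : uniq (sites n).
Proof. by rewrite map_inj_uniq ?iota_uniq// => i j []. Qed.

Lemma run_prob n (A : set R) : measurable A -> (0 < P (xi 0 @^-1` A))%E ->
  (0 < P (\bigcap_(x in [set` sites n]) xi x @^-1` A))%E.
Proof.
move=> mA A0; rewrite (xi_indep (A := fun=> A))//.
under eq_bigr do rewrite xi_prob//.
rewrite -(xi_prob 0 mA); elim: (sites n) => [|x s IH]; first by rewrite big_nil.
by rewrite big_cons mule_gt0.
Qed.

Section discretize.
Variable dl : R.
Hypothesis dl_gt0 : 0 < dl.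

Let I := 'I_(Num.truncn (- b / dl)).+1.
Definition xi_level (i : nat) (w : T) : I := level b dl (xi i%:Z w).
Definition level_prob (j : I) : R := fine (eta [set y | level b dl y = j]).

Let eta_fin (j : I) : eta [set y | level b dl y = j] = (level_prob j)%:E.
Proof.
by rewrite fineK//; apply: fin_num_measure; exact: measurable_level.
Qed.

Lemma level_prob_ge0 j : 0 <= level_prob j.
Proof. by rewrite fine_ge0. Qed.

(** Words begin at site 1, so site [x] carries the letter of index [x - 1]. *)
Let A (v : seq I) (x : int) : set R :=
  [set y | level b dl y = nth ord0 v `|x|%N.-1].

Let xi_pathE (v : seq I) : [set w | env_path xi_level (size v) w = v] =
  \bigcap_(x in [set` sites (size v)]) xi x @^-1` A v x.
Proof.
apply/seteqP; split => w /=.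
- move=> vE x /mapP[i]; rewrite mem_iota add1n => /andP[i0 iv] ->.
  change (level b dl (xi i%:Z w) = nth ord0 v i.-1).
  rewrite -[in RHS]vE (nth_map 0%N); last by rewrite size_iota -ltnS prednK.
  by rewrite nth_iota ?add1n ?prednK// -ltnS prednK.
- move=> H; apply: (@eq_from_nth _ ord0); first by rewrite size_map size_iota.
  rewrite size_map size_iota => i iv.
  rewrite (nth_map 0%N) ?size_iota// nth_iota// add1n.
  by apply: (H i.+1%:Z); apply/mapP; exists i.+1 => //; rewrite mem_iota add1n.
Qed.

Let mA v x : measurable (A v x).
Proof. exact: measurable_level. Qed.

Lemma xi_path_meas v : measurable [set w | env_path xi_level (size v) w = v].
Proof.
rewrite xi_pathE; apply: fin_bigcap_measurable => [|x _]; first exact: finite_seq.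
by apply: measurable_funPTI; exact: mA.
Qed.

Lemma xi_path_law v : P [set w | env_path xi_level (size v) w = v] =
  (\prod_(j <- v) level_prob j)%:E.
Proof.
rewrite xi_pathE xi_indep//.
rewrite big_map -(prodEFin _ _ level_prob) [RHS](big_nth ord0).
rewrite -[X in iota 1 X]subn0 -/(index_iota _ _) .
rewrite (iotaDl 1 0) big_map; apply: eq_big_nat => i _.
by rewrite xi_prob// -eta_fin.
Qed.

Lemma level_prob_sum : \sum_j level_prob j = 1.
Proof.
have := integral_path xi_path_meas xi_path_law 1 (f := fun=> 1) (fun=> ler01).
rewrite integral_cst// mul1e => H.
have /= [->] := etrans (esym (probability_setT P)) H.
by apply: eq_bigr => j _; rewrite mulr1.
Qed.

End discretize.
End environment.

(** * The Lyapunov exponents *)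

Lemma cvg_affine_inv (R : realType) (x c : R) :
  x + c * n%:R^-1 @[n --> \oo] --> x.
Proof.
rewrite -[X in _ --> X]addr0 -(mulr0 c).
apply: cvgD; [exact: cvg_cst|apply: cvgMr].
apply/gtr0_cvgV0; last exact: cvgr_idn.
by near=> n; rewrite ltr0n; near: n; exists 1%N.
Unshelve. all: by end_near. Qed.

Section lyapunov.
Context (R : realType) (d : measure_display) (T : measurableType d).
Context (P : probability T R) (kappa h b : R) (eta : probability R R).
Context (xi : int -> {RV P >-> R}) (u : T -> R -> int -> R).
Context (lambda0 : R) (lambda : R -> R).
Hypotheses (kappa_gt0 : 0 < kappa) (h_gt0 : 0 < h) (h_le1 : h <= 1).
Hypothesis eta_supp : eta `[b, 0]%classic = 1%E.
Hypothesis xi_indep : mutually_independent xi.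
Hypothesis xi_law : forall x, has_law (xi x) eta.
Hypothesis xi_esssup : ess_sup P (fun w => (xi 0 w)%:E) = 0%E.
Hypothesis u_sol :
  {ae P, forall w, pam_solution kappa h (fun x => xi x w) (u w)}.
Hypothesis lambda0_def : is_quenched_lyapunov P u lambda0.
Hypothesis lambda_def : forall p, 0 < p -> is_annealed_lyapunov P u p (lambda p).

(** The rates [p] and [q] are those of jumps to the right and to the left. *)
Let p := kappa * ((1 + h) / 2).
Let q := kappa * ((1 - h) / 2).

Let p_gt0 : 0 < p.
Proof. by rewrite mulr_gt0// divr_gt0// addr_gt0. Qed.

Let q_ge0 : 0 <= q.
Proof. by apply: mulr_ge0; [exact: ltW|rewrite divr_ge0// subr_ge0]. Qed.

Let pqE : p + q = kappa.
Proof. by rewrite /p /q; field. Qed.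

Let qp : q < p.
Proof.
rewrite /q /p ltr_pM2l// ltr_pM2r// ?invr_gt0// ltrD2l.
by apply: lt_trans h_gt0; rewrite oppr_lt0.
Qed.

Record regular (w : T) : Prop := Regular {
  reg_itv : forall x, b <= xi x w <= 0 ;
  reg_sol : pam_solution kappa h (fun x => xi x w) (u w) ;
  reg_lim : t^-1 * ln (u w t 0) @[t --> +oo] --> lambda0 }.

Lemma ae_regular : {ae P, forall w, regular w}.
Proof.
have H := xi_itv eta_supp xi_law.
by apply: filterS3 H u_sol lambda0_def => w; exact: Regular.
Qed.

Lemma regular_exists (A : set T) : measurable A -> (0 < P A)%E ->
  exists2 w, A w & regular w.
Proof.
move=> mA A0; apply: contrapT => H.
have [N [mN N0 subN]] := ae_regular.
have : (P A <= P N)%E.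
  apply: le_measure; rewrite ?inE// => w Aw; apply: subN => /= rw.
  by apply: H; exists w.
by rewrite N0 leNgt A0.
Qed.

Section regular_env.
Variable w : T.
Hypothesis reg : regular w.

Let V_itv := reg_itv reg.
Let v_init := pam_init (reg_sol reg).
Let v_diff := pam_diff (reg_sol reg).
Let v_ge0 := fun t x => @pam_ge0 _ _ _ _ _ (reg_sol reg) t x.
Let v_bdd := pam_bounded (reg_sol reg).

Lemma reg_le1 t x : 0 <= t -> u w t x <= 1.
Proof. exact: (pam_le1 p_gt0 q_ge0 pqE V_itv v_init v_diff v_ge0 v_bdd). Qed.

Lemma reg_ge t x : 0 <= t -> expR (- (kappa - b) * t) <= u w t x.
Proof. exact: (pam_gt p_gt0 q_ge0 V_itv v_init v_diff v_ge0). Qed.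

Lemma reg_ge0 t x : 0 <= t -> 0 <= u w t x.
Proof. exact: v_ge0. Qed.

Lemma reg_taylor_cvg t x : 0 <= t ->
  pam_taylor p q kappa (fun x => xi x w) n t x @[n --> \oo] --> u w t x.
Proof.
exact: (pam_taylor_cvg p_gt0 q_ge0 pqE V_itv v_init v_diff v_ge0 v_bdd).
Qed.

Lemma reg_laplace (be be' C : R) : be' < be ->
  (forall t, 0 <= t -> u w t 0 <= C * expR (be' * t)) ->
  exists B, exists2 c : R, 0 < c & forall n, exists U : nat -> R,
    [/\ U 1 <= B, forall i, c <= U i & forall i, (i < n)%N ->
      p * U i.+2 + q * U i <= (kappa + be - xi i.+1 w) * U i.+1].
Proof. exact: (pam_laplace p_gt0 q_ge0 V_itv v_init v_diff v_ge0). Qed.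

Lemma reg_subsolution (be t : R) : 0 <= t -> 0 < kappa + be ->
  exists f : int -> R, [/\ forall x, 0 <= f x <= expR (`|be| * t),
    u w t 0 <= expR (be * t) * f 0 &
    forall x, (kappa + be - xi x w) * f x <=
      p * f (x + 1) + q * f (x - 1) + (kappa + be - b)].
Proof.
exact: (pam_subsolution p_gt0 q_ge0 pqE V_itv v_init v_diff v_ge0 v_bdd).
Qed.

(** Up to the time from which the limit gives the bound, [u <= 1] and the constant [C] absorbs the
    exponential. *)
Lemma reg_le_exp (e : R) : 0 < e ->
  exists C, forall t : R, 0 <= t -> u w t 0 <= C * expR ((lambda0 + e) * t).
Proof.
move=> e0; have /cvgrPdist_le/(_ e e0)[S [_ HS]] := reg_lim reg.
exists (expR (`|lambda0 + e| * `|S|)) => t t0.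
have [St|tS] := ltP `|S| t.
  have tp : 0 < t by apply: le_lt_trans St; exact: normr_ge0.
  have /HS /ler_normlP[+ _] : S < t by apply: le_lt_trans St; exact: ler_norm.
  rewrite opprB lerBlDr ler_pdivrMl// => lnu.
  have up : 0 < u w t 0 by apply: lt_le_trans (reg_ge 0 t0); exact: expR_gt0.
  apply: (@le_trans _ _ (expR ((lambda0 + e) * t))).
    by rewrite -ler_ln ?posrE ?expR_gt0// expRK mulrC addrC.
  by rewrite ler_peMl ?expR_ge0// -expR0 ler_expR mulr_ge0.
apply: (le_trans (reg_le1 0 t0)); rewrite -expRD -expR0 ler_expR.
rewrite -lerBlDr sub0r; apply: (le_trans (ler_norm _)).
by rewrite normrN normrM (ger0_norm t0) ler_wpM2l.
Qed.

End regular_env.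

Let above (e : R) : set R := `]- e, +oo[%classic.

Let above_meas e : measurable (above e).
Proof. exact: measurable_itv. Qed.

(** Otherwise [- e] would be an essential upper bound of [xi 0]. *)
Lemma xi_near0_prob (e : R) : 0 < e -> (0 < P (xi 0 @^-1` above e))%E.
Proof.
move=> e0; rewrite lt_neqAle measure_ge0 andbT; apply/negP => /eqP P0.
have : (ess_sup P (fun w => (xi 0 w)%:E) <= (- e)%:E)%E.
  apply/ess_supP; exists (xi 0 @^-1` above e); split => //.
    exact: measurable_funPTI.
  by move=> w /=; rewrite /above lee_fin /= in_itv/= andbT => /negP; rewrite -ltNge.
by rewrite xi_esssup lee_fin oppr_ge0 leNgt e0.
Qed.

(** A run of [n] sites with [xi > - e] has positive probability, hence occurs in some regular
    environment. There the Laplace transform is a positive supersolution of the kind that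
    [no_long_run] excludes. *)
Lemma quenched_ge : 2 * Num.sqrt (p * q) <= kappa + lambda0.
Proof.
rewrite leNgt; apply/negP => lt.
(* Three of the four quarters of the gap are spent: two on the rates
   [lambda0 + e < lambda0 + e + e], one on [xi > - e]. *)
pose e := (2 * Num.sqrt (p * q) - (kappa + lambda0)) / 4.
have e0 : 0 < e by rewrite divr_gt0// subr_gt0.
have [n run] : exists n, forall U : nat -> R, (forall i, 0 < U i) ->
    ~ forall i, (i < n)%N ->
      p * U i.+2 + q * U i <= (kappa + (lambda0 + e + e) + e) * U i.+1.
  by apply: no_long_run => //; rewrite /e; lra.
have [|w wA rw] := @regular_exists
  (\bigcap_(x in [set` [seq i%:Z | i <- iota 1 n]]) xi x @^-1` above e) _
  (run_prob xi_indep xi_law n (above_meas e) (xi_near0_prob e0)).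
  apply: fin_bigcap_measurable => [|x _]; first exact: finite_seq.
  exact: measurable_funPTI.
have [C uC] := reg_le_exp rw e0.
have ee : lambda0 + e < lambda0 + e + e by rewrite ltrDl.
have [B [c c0 /(_ n)[U [_ cU super]]]] := reg_laplace rw ee uC.
apply: (run U) => [i|i ni]; first exact: lt_le_trans (cU i).
apply: (le_trans (super i ni)); rewrite ler_wpM2r//.
  by apply: le_trans (cU _); exact: ltW.
have : i.+1%:Z \in [seq i%:Z | i <- iota 1 n].
  by apply/mapP; exists i.+1 => //; rewrite mem_iota add1n.
move=> /(wA _); rewrite /above /= in_itv/= andbT; lra.
Qed.

(** * Upper bound for the annealed exponents *)

Section upper.
Variable dl : R.
Hypothesis dl_gt0 : 0 < dl.

Let a0 := kappa + lambda0 + 2 * dl.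
Let I := 'I_(Num.truncn (- b / dl)).+1.
(** With [j] the level of [xi], the rounding gives [kappa + lambda0 + dl - xi <= a j] and [a j + dl
    <= kappa + lambda0 + 3 * dl - xi]: [a] suits the quenched supersolution, [a + dl] the annealed
    subsolution. *)
Let a (j : I) := a0 + j%:R * dl.
Let J := xi_level b xi dl.
Let pi : I -> R := level_prob eta (dl := dl).
Let rm := ratio_max p a0.

Let a0_gt0 : 0 < a0.
Proof.
have := quenched_ge; have := sqrtr_ge0 (p * q); have := dl_gt0; rewrite /a0; lra.
Qed.

(** By [quenched_ge], [a0] exceeds [2 * Num.sqrt (p * q)]. *)
Let a0_pq : 4 * p * q < a0 ^+ 2.
Proof.
have s0 := sqrtr_ge0 (p * q).
have -> : 4 * p * q = (2 * Num.sqrt (p * q)) ^+ 2.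
  rewrite exprMn sqr_sqrtr; first by ring.
  by apply: mulr_ge0 => //; exact: ltW.
rewrite ltr_pXn2r ?nnegrE ?(ltW a0_gt0) ?mulr_ge0//.
by have := quenched_ge; have := dl_gt0; rewrite /a0; lra.
Qed.

Let aA j : a0 <= a j <= a0 + (Num.truncn (- b / dl))%:R * dl.
Proof.
rewrite lerDl mulr_ge0 ?(ltW dl_gt0)//= lerD2l ler_wpM2r ?(ltW dl_gt0)//.
by rewrite ler_nat -ltnS ltn_ord.
Qed.

Let pi_ge0 j : 0 <= pi j. Proof. exact: level_prob_ge0. Qed.

Let pi_sum : \sum_j pi j = 1.
Proof. exact: (level_prob_sum b xi_indep xi_law dl). Qed.

Let path_law := xi_path_law (b := b) xi_indep xi_law (dl := dl).
Let path_meas := xi_path_meas (b := b) xi (dl := dl).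

Let map_path (f : I -> R) n w :
  map f (env_path J n w) = [seq f (J i w) | i <- iota 1 n].
Proof. by rewrite /env_path -map_comp. Qed.

(** The Laplace transform at [lambda0 + dl] is a supersolution for the rounded coefficients; it is
    at most [B] at site 1 and at least [c] everywhere, uniformly in [n]. *)
Lemma low_prod_bounded w : regular w -> exists C, forall n,
  ratio_prod p q 0 (map a (env_path J n w)) <= C.
Proof.
move=> rw; have [C0 uC] := reg_le_exp rw (divr_gt0 dl_gt0 (ltr0n _ 2)).
have ee : lambda0 + dl / 2 < lambda0 + dl by have := dl_gt0; rewrite ltrD2l; lra.
have [B [c c0 lap]] := reg_laplace rw ee uC.
exists (B / c) => n; have [U [U1 cU super]] := lap n.
have U0 i : 0 <= U i by apply: le_trans (cU i); exact: ltW.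
rewrite ler_pdivlMr// map_path.
have := supersolution_prod p_gt0 q_ge0 a0_gt0 a0_pq (a := fun i => a (J i w)) (U := U) (n := n).
move=> H; have {H} : ratio_prod p q 0 [seq a (J i w) | i <- iota 1 n] * U n.+1 <= U 1.
  apply: H => // [i|i ni]; first by have /andP[] := aA (J i w).
  apply: (le_trans (super i ni)); rewrite ler_wpM2r//.
  have /andP[_] := levelP dl_gt0 (reg_itv rw i.+1).
  by rewrite -/(J i.+1 w) /a /a0 -natr1; lra.
move=> /le_trans/(_ U1); apply: le_trans; rewrite ler_wpM2l//.
apply/ltW/(ratio_prod_gt0 p_gt0 q_ge0 a0_gt0 a0_pq) => //.
  by apply/allP => _ /mapP[i _ ->]; have /andP[] := aA (J i w).
exact/ltW/ratio_max_gt0.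
Qed.

Lemma low_pexp_sublinear (e : R) : 0 < e -> \forall n \near \oo,
  pexp pi n (fun v => ln (ratio_prod p q 0 (map a v))) <= e * n%:R.
Proof.
move=> e0; have alla v : all (>= a0) (map a v).
  by apply/allP => _ /mapP[j _ ->]; have /andP[] := aA j.
have rm0 : 0 < rm by exact: ratio_max_gt0.
have L0 v : 0 < ratio_prod p q 0 (map a v).
  by apply: (ratio_prod_gt0 p_gt0 q_ge0 a0_gt0 a0_pq) => //; exact: ltW.
apply: (pexp_sublinear pi_ge0 path_meas path_law (B := `|ln rm|)) => //.
  move=> v; have := ratio_prod_le_exp p_gt0 q_ge0 a0_gt0 a0_pq (alla v) (ltW rm0).
  rewrite size_map -ler_ln ?posrE ?exprn_gt0// => /le_trans; apply.
  by rewrite lnXn// -[leLHS]mulr_natr ler_wpM2r// ler_norm.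
apply: filterS ae_regular => w rw; have [C LC] := low_prod_bounded rw.
exists (ln C) => n; rewrite ler_ln ?posrE//; last exact: lt_le_trans (LC n).
Qed.

Let G v := ratio_prod p q rm [seq a j + dl | j <- v].

Lemma reg_upper : exists2 c : R, 0 < c & forall w (t : R) N, regular w -> 0 <= t ->
  u w t 0 <= expR ((lambda0 + 3 * dl) * t) *
    (rm * (c * (\sum_(n < N) G (take n (env_path J N w))) +
           G (env_path J N w) * expR (`|lambda0 + 3 * dl| * t)) + c).
Proof.
set be := lambda0 + 3 * dl.
have kb : 0 < kappa + be by have := a0_gt0; have := dl_gt0; rewrite /a0 /be; lra.
have b0 : b <= 0.
  have [|w _ rw] := regular_exists measurableT.
    by apply: (@lt_le_trans _ _ 1%E) => //; rewrite -(probability_setT P); exact: lexx.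
  by have /andP[] := reg_itv rw 0; exact: le_trans.
have C0 : 0 <= kappa + be - b by lra.
have [c c0 sub] := subsolution_prod p_gt0 q_ge0 qp a0_gt0 a0_pq C0.
exists c => // w t N rw t0; have [f [fM uf fsub]] := reg_subsolution rw t0 kb.
(* Negative sites keep the exact coefficient, since only sites 1, 2, ... enter the products. *)
pose abar x := if x is Posz i then a (J i w) + dl else kappa + be - xi x w.
have abar_le x : abar x <= kappa + be - xi x w.
  case: x => [i|i] //=; have /andP[] := levelP dl_gt0 (reg_itv rw i).
  by rewrite -/(J i w) /a /a0 /be; lra.
have abar_ge x : a0 <= abar x.
  case: x => [i|i] /=.
    by have /andP[ai _] := aA (J i w); rewrite (le_trans ai)// lerDl ltW.
  have /andP[_] := reg_itv rw (Negz i); rewrite /a0 /be; have := dl_gt0; lra.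
have [x|f0 f1] := sub abar f _ abar_ge fM.
  apply: le_trans (fsub x); rewrite ler_wpM2r//; by have /andP[] := fM x.
apply: (le_trans uf); rewrite ler_wpM2l ?expR_ge0//.
apply: (le_trans f0); rewrite lerD2r ler_wpM2l//; first exact/ltW/ratio_max_gt0.
apply: (le_trans (f1 N)).
have E n : [seq abar i%:Z | i <- iota 1 n] = [seq a j + dl | j <- env_path J n w].
  by rewrite /env_path -map_comp.
rewrite E -/(G _) lerD2r ler_wpM2l ?(ltW c0)//.
(* All partial products are read off prefixes of the single word of length [N]. *)
apply: ler_sum => n _; rewrite E -/(G _) /env_path -map_take take_iota.
by rewrite (minn_idPl (ltnW (ltn_ord n))).
Qed.

Lemma annealed_moment_le : exists2 s0 : R, 0 < s0 &
  forall s : R, 0 < s -> s < s0 -> exists X : R, forall t : R, 0 <= t ->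
  ('E_P[fun w => (u w t 0 `^ s)%R] <= (X * expR ((lambda0 + 3 * dl) * t) `^ s)%R%:E)%E.
Proof.
set be := lambda0 + 3 * dl.
have [s1 s10 mom] := moment_sum_bound pi_ge0 pi_sum p_gt0 q_ge0 a0_gt0 a0_pq
  dl_gt0 aA low_pexp_sublinear.
have [c c0 up] := reg_upper.
exists (Num.min s1 1); first by rewrite lt_min s10 ltr01.
move=> s sp; rewrite lt_min => /andP[ss1 s1'].
have [[B sumB] vanish] := mom s sp ss1.
have rm0 : 0 <= rm by exact/ltW/ratio_max_gt0.
have G0 v : 0 < G v.
  apply: (ratio_prod_gt0 p_gt0 q_ge0 a0_gt0 a0_pq) => //.
  rewrite all_map; apply/allP => j _ /=; have /andP[aj _] := aA j.
  by rewrite (le_trans aj)// lerDl ltW.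
exists (rm `^ s * (c `^ s * B) + c `^ s) => t t0.
set E := expR (be * t); set M := expR (`|be| * t).
have key N : ('E_P[fun w => (u w t 0 `^ s)%R] <=
   (E `^ s * (rm `^ s * (c `^ s * (\sum_(n < N) pexp pi n (fun v => G v `^ s)) +
     M `^ s * pexp pi N (fun v => G v `^ s)) + c `^ s))%R%:E)%E.
  pose F v := E `^ s * (rm `^ s * (c `^ s * (\sum_(n < N) G (take n v) `^ s) +
     M `^ s * G v `^ s) + c `^ s).
  have F0 v : 0 <= F v.
    rewrite mulr_ge0 ?powR_ge0// addr_ge0 ?powR_ge0// mulr_ge0 ?powR_ge0//.
    rewrite addr_ge0 ?mulr_ge0 ?powR_ge0// sumr_ge0// => n _; exact: powR_ge0.
  have FE : pexp pi N F = E `^ s * (rm `^ s * (c `^ s *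
     (\sum_(n < N) pexp pi n (fun v => G v `^ s)) +
     M `^ s * pexp pi N (fun v => G v `^ s)) + c `^ s).
    rewrite /F pexpZ pexpD (pexp_cst pi_sum) pexpZ pexpD !pexpZ.
    congr (_ * (_ * (_ * _ + _) + _)).
    transitivity (\sum_(n < N) pexp pi N (fun v => G (take n v) `^ s)).
      exact: (pexp_sum pi N (fun n v => G (take n v) `^ s)).
    by apply: eq_bigr => n _; rewrite (pexp_take pi_ge0 pi_sum (fun v => G v `^ s))// ltnW.
  rewrite -FE -(integral_path path_meas path_law N F0) expectation.unlock.
  apply: ge0_ae_le_integral_gen => [w|w|]; rewrite ?lee_fin ?powR_ge0//.
  apply: filterS ae_regular => w rw; rewrite lee_fin.
  have h0 := up w t N rw t0.
  have sum0 : 0 <= \sum_(n < N) G (take n (env_path J N w)).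
    by apply: sumr_ge0 => n _; exact: ltW.
  have GM0 : 0 <= G (env_path J N w) * M by rewrite mulr_ge0 ?expR_ge0// ltW.
  have csum0 := mulr_ge0 (ltW c0) sum0.
  have X0 := addr_ge0 csum0 GM0.
  have Y0 := addr_ge0 (mulr_ge0 rm0 X0) (ltW c0).
  apply: (@le_trans _ _ (E `^ s * ((rm * (c * (\sum_(n < N)
      G (take n (env_path J N w))) + G (env_path J N w) * M) + c) `^ s))).
    rewrite -powRM ?expR_ge0//; apply: ge0_ler_powR; rewrite ?nnegrE//.
    - exact: ltW.
    - exact: reg_ge0.
    - by rewrite mulr_ge0// expR_ge0.
  rewrite ler_wpM2l ?powR_ge0//.
  apply: (le_trans (powR_subadd sp (ltW s1') (mulr_ge0 rm0 X0) (ltW c0))).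
  rewrite lerD2r powRM// ler_wpM2l ?powR_ge0//.
  apply: (le_trans (powR_subadd sp (ltW s1') csum0 GM0)).
  rewrite (powRM _ (ltW c0) sum0) (powRM _ (ltW (G0 _)) (expR_ge0 _)).
  rewrite [X in _ + X <= _]mulrC lerD2r ler_wpM2l ?powR_ge0//.
  have Gn0 n : 0 <= G (take n (env_path J N w)) by exact: ltW.
  exact: (@powR_sum_le R s N (fun n => G (take n (env_path J N w))) sp (ltW s1') Gn0).
have E0 : (0 <= 'E_P[fun w => (u w t 0 `^ s)%R])%E.
  rewrite expectation.unlock; apply: integral_ge0 => w _.
  by rewrite lee_fin powR_ge0.
have Efin : ('E_P[fun w => (u w t 0 `^ s)%R])%E \is a fin_num.
  by rewrite ge0_fin_numE//; apply: le_lt_trans (key 0%N) _; rewrite ltry.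
rewrite -(fineK Efin) lee_fin; set y := fine _.
(* The length [N] is still free: the sums are replaced by [B], and what remains is at most a
   constant times the [N]-th moment. *)
rewrite -subr_le0; apply: (vanish (E `^ s * (rm `^ s * M `^ s))).
  by rewrite !mulr_ge0 ?powR_ge0.
move=> N; have := key N; rewrite -(fineK Efin) lee_fin -/y.
rewrite -/G; set S := \sum_(n < N) _; set g := pexp _ N _ => yle.
have SB : S <= B by exact: sumB.
have := ler_wpM2l (mulr_ge0 (powR_ge0 E s) (mulr_ge0 (powR_ge0 rm s) (powR_ge0 c s))) SB.
move: (E `^ s) (rm `^ s) (M `^ s) (c `^ s) (y) (S) (g) yle => e1 e2 e3 e4 e5 e6 e7; lra.
Qed.

End upper.

(** * Lower bound for the annealed exponents *)

Section lower.

Lemma measurable_pam_coef n x :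
  measurable_fun setT (fun w => pam_coef p q kappa (fun y => xi y w) n x).
Proof.
elim: n x => [|n IH] x /=; first exact: measurable_cst.
apply: measurable_funB; last first.
  by apply: measurable_funM => //; exact: measurable_funB.
by apply: measurable_funD; apply: measurable_funM.
Qed.

(* A measurable version of [u], which is not assumed to be measurable itself. *)
Let um (t : R) (w : T) : R :=
  fine (limn_esup (fun n => (pam_taylor p q kappa (fun y => xi y w) n t 0)%:E)).

Let measurable_um t : measurable_fun setT (um t).
Proof.
apply: measurableT_comp; first exact: fine_measurable.
apply: measurable_fun_limn_esup => n; apply/measurable_EFinP.
apply: measurable_sum => i; apply: measurable_funM => //.
exact: measurable_pam_coef.
Qed.

Let umE (t : R) w : 0 <= t -> regular w -> um t w = u w t 0.
Proof.
move=> t0 rw; pose f n := (pam_taylor p q kappa (fun y => xi y w) n t 0)%:E.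
have H : f n @[n --> \oo] --> (u w t 0)%:E.
  by apply/fine_cvgP; split; [exact: nearW|exact: reg_taylor_cvg].
by rewrite /um (cvg_limn_einf_sup H).2.
Qed.

Lemma moment_fin_num (s t : R) : 0 < s -> 0 <= t ->
  ('E_P[fun w => (u w t 0 `^ s)%R])%E \is a fin_num.
Proof.
move=> s0 t0; rewrite expectation.unlock ge0_fin_numE; last first.
  by apply: integral_ge0 => w _; rewrite lee_fin powR_ge0.
apply: (@le_lt_trans _ _ (\int[P]_w (cst 1%E w))%E).
  apply: ge0_ae_le_integral_gen => [w|w|]; rewrite ?lee_fin ?powR_ge0//.
  apply: filterS ae_regular => w rw; rewrite lee_fin.
  rewrite [leRHS](_ : 1 = 1 `^ s); last by rewrite powR1.
  by apply: ge0_ler_powR; rewrite ?nnegrE ?(ltW s0) ?reg_ge0 ?reg_le1.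
rewrite integral_cst// mul1e; apply: (@le_lt_trans _ _ 1%E); last exact: ltry.
exact: probability_le1.
Qed.

(** The event [u >= expR ((lambda0 - e) * k)] holds eventually in every regular environment, so its
    probability tends to 1 and eventually exceeds one half. *)
Lemma annealed_moment_ge (s e : R) : 0 < s -> 0 < e -> \forall k \near \oo,
  ((expR ((lambda0 - e) * k%:R) `^ s / 2)%R%:E <=
   'E_P[fun w => (u w k%:R 0 `^ s)%R])%E.
Proof.
move=> s0 e0; pose B (k : nat) := [set w | expR ((lambda0 - e) * k%:R) <= um k%:R w].
have mB k : measurable (B k).
  rewrite (_ : B k = um k%:R @^-1` `[expR ((lambda0 - e) * k%:R), +oo[%classic).
    rewrite -[X in measurable X]setTI; apply: measurable_um; [exact: measurableT|].
    apply measurable_itv.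
  by apply/seteqP; split => w /=; rewrite in_itv/= andbT.
have Bev w : regular w -> \forall k \near \oo, B k w.
  move=> rw; have /cvgrPdist_le/(_ e e0)[S [_ HS]] := reg_lim rw.
  near=> k.
  have k0 : 0 < k%:R :> R by rewrite ltr0n; near: k; exists 1%N.
  have /HS /ler_normlP[_] : S < k%:R by near: k; exact: nbhs_infty_gtr.
  rewrite lerBlDr -lerBlDl ler_pdivlMl// => lnu.
  rewrite /B /= umE ?(ltW k0)//.
  have up : 0 < u w k%:R 0.
    by apply: lt_le_trans (reg_ge rw 0 (ltW k0)); exact: expR_gt0.
  by rewrite -ler_ln ?posrE ?expR_gt0// expRK mulrC.
have : (\int[P]_w (\1_(B k) w)%:E)%E @[k --> \oo] --> (\int[P]_w (cst 1%E w))%E.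
  have [] // := @dominated_convergence _ _ _ P setT measurableT
    (fun k w => (\1_(B k) w)%:E) (cst 1%E) (EFin \o cst 1).
  - by move=> k; apply/measurable_EFinP; exact: measurable_indic.
  - apply: filterS ae_regular => w rw _; apply: cvg_near_cst.
    by apply: filterS (Bev w rw) => k Bk; rewrite indicE mem_set.
  - exact: finite_measure_integrable_cst.
  - by apply: aeW => w k _ /=; rewrite lee_fin indicE; case: (_ \in _); rewrite ?normr1 ?normr0.
rewrite integral_cst// mul1e => PB.
have {}PB : (P (B k)) @[k --> \oo] --> 1%E.
  rewrite -(probability_setT P); apply: cvg_trans PB; apply: near_eq_cvg.
  by apply: nearW => k; rewrite integral_indic// setIT.
have Phalf : \forall k \near \oo, (2^-1%:E < P (B k))%E.
  have h0 : 0 < 2^-1 :> R by rewrite invr_gt0.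
  have /fine_cvgP[_ /cvgrPdist_lt/(_ _ h0)] := PB; apply: filterS => k /=.
  rewrite -[X in (_ < X)%E]fineK ?fin_num_measure// lte_fin => /ltr_normlP[_]; lra.
apply: filterS Phalf => k /ltW Pk.
set c := expR _ `^ s.
have c0 : 0 <= c by exact: powR_ge0.
apply: (@le_trans _ _ (\int[P]_w (c * \1_(B k) w)%:E)%E).
  under eq_integral do rewrite EFinM.
  rewrite ge0_integralZl_EFin//=; last first.
    by apply/measurable_EFinP; exact: measurable_indic.
  by rewrite integral_indic// setIT EFinM lee_wpmul2l.
rewrite expectation.unlock; apply: ge0_ae_le_integral_gen => [w|w|].
- by rewrite lee_fin mulr_ge0.
- by rewrite lee_fin powR_ge0.
apply: filterS ae_regular => w rw; rewrite lee_fin indicE.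
have [|] := boolP (w \in B k); last by rewrite mulr0 powR_ge0.
rewrite inE mulr1 /B/= umE// => cu.
by apply: ge0_ler_powR => //; rewrite ?nnegrE ?(ltW s0) ?expR_ge0// reg_ge0.
Unshelve. all: by end_near. Qed.

End lower.

Let lambda_cvgn (s : R) : 0 < s ->
  k%:R^-1 * (s^-1 * ln (fine 'E_P[fun w => u w k%:R 0 `^ s])) @[k --> \oo]
    --> lambda s.
Proof.
move=> s0; under eq_fun do rewrite -ln_powR.
exact: (cvg_comp _ _ (@cvgr_idn R) (lambda_def s0)).
Qed.

Lemma quenched_le_annealed (s : R) : 0 < s -> lambda0 <= lambda s.
Proof.
move=> s0; apply/ler_addgt0Pl => e e0; rewrite -lerBlDl.
(* The factor one half contributes a term of order [1 / k] to the exponent. *)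
apply: (ler_cvg_to (@cvg_affine_inv R (lambda0 - e) (s^-1 * ln 2^-1)) (lambda_cvgn s0)).
near=> k.
have k0 : 0 < k%:R :> R by rewrite ltr0n; near: k; exists 1%N.
have : ((expR ((lambda0 - e) * k%:R) `^ s / 2)%R%:E <=
   'E_P[fun w => (u w k%:R 0 `^ s)%R])%E by near: k; exact: annealed_moment_ge.
rewrite -(fineK (moment_fin_num s0 (ltW k0))) lee_fin; set y := fine _ => cy.
have c0 : 0 < expR ((lambda0 - e) * k%:R) `^ s / 2.
  by rewrite divr_gt0// powR_gt0// expR_gt0.
have y0 := lt_le_trans c0 cy.
move: cy; rewrite -ler_ln ?posrE//.
rewrite lnM ?posrE ?powR_gt0 ?expR_gt0// ln_powR expRK => cy.
rewrite -(ler_pM2l k0) mulVKf ?gt_eqF// -(ler_pM2l s0) [leRHS]mulVKf ?gt_eqF//.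
apply: le_trans cy; rewrite le_eqVlt; apply/orP; left; apply/eqP; field.
by rewrite !gt_eqF.
Unshelve. all: by end_near. Qed.

Lemma annealed_le (dl : R) : 0 < dl -> exists2 s0 : R, 0 < s0 &
  forall s : R, 0 < s -> s < s0 -> lambda s <= lambda0 + 3 * dl.
Proof.
move=> dl0; have [s0 s00 mom] := annealed_moment_le dl0.
exists s0 => // s sp ss0; have [X EX] := mom s sp ss0.
apply: (ler_cvg_to (lambda_cvgn sp) (@cvg_affine_inv R (lambda0 + 3 * dl) (s^-1 * ln X))).
near=> k.
have k0 : 0 < k%:R :> R by rewrite ltr0n; near: k; exists 1%N.
(* This lower bound only serves to make the moment positive, so that logarithms can be compared. *)
have : ((expR ((lambda0 - 1) * k%:R) `^ s / 2)%R%:E <=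
   'E_P[fun w => (u w k%:R 0 `^ s)%R])%E by near: k; exact: annealed_moment_ge.
have := EX _ (ltW k0).
rewrite -(fineK (moment_fin_num sp (ltW k0))) !lee_fin; set y := fine _ => yX cy.
have y0 : 0 < y.
  by apply: lt_le_trans cy; rewrite divr_gt0// powR_gt0// expR_gt0.
have E0 : 0 < expR ((lambda0 + 3 * dl) * k%:R) `^ s by rewrite powR_gt0// expR_gt0.
have X0 : 0 < X by have := lt_le_trans y0 yX; rewrite pmulr_lgt0.
move: yX; rewrite -ler_ln ?posrE ?mulr_gt0// lnM ?posrE// ln_powR expRK => yX.
rewrite -(ler_pM2l k0) mulVKf ?gt_eqF// -(ler_pM2l sp) mulVKf ?gt_eqF//.
apply: (le_trans yX); rewrite le_eqVlt; apply/orP; left; apply/eqP; field.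
by rewrite !gt_eqF.
Unshelve. all: by end_near. Qed.

Lemma annealed_cvg : lambda p @[p --> 0^'+] --> lambda0.
Proof.
apply/cvgrPdist_le => e e0.
have [s0 s00 up] := annealed_le (divr_gt0 e0 (ltr0n R 3)).
near=> s.
have sp : 0 < s by near: s; exact: nbhs_right_gt.
have ss0 : s < s0 by near: s; exact: nbhs_right_lt.
have lo := quenched_le_annealed sp; have := up s sp ss0.
by rewrite ler0_norm ?subr_le0//; lra.
Unshelve. all: by end_near. Qed.

End lyapunov.

Unset Implicit Arguments.
Set Strict Implicit.
Set Printing Implicit Defensive.

Theorem theorem2p9 (R : realType) (d : measure_display) (T : measurableType d)
  (P : probability T R) (kappa h b : R) (eta : probability R R)
  (xi : int -> {RV P >-> R}) (u : T -> R -> int -> R)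
  (lambda0 : R) (lambda : R -> R)
  (kappa_gt0 : 0 < kappa) (h_gt0 : 0 < h) (h_le1 : h <= 1) (b_lt0 : b < 0)
  (eta_supp : eta `[b, 0]%classic = 1%E)
  (xi_indep : mutually_independent xi)
  (xi_law : forall x, has_law (xi x) eta)
  (xi_nonconst : ~ exists c : R, {ae P, forall w, xi 0 w = c})
  (xi_esssup : ess_sup P (fun w => (xi 0 w)%:E) = 0%E)
  (u_sol : {ae P, forall w, pam_solution kappa h (fun x => xi x w) (u w)})
  (lambda0_def : is_quenched_lyapunov P u lambda0)
  (lambda_def : forall p, 0 < p -> is_annealed_lyapunov P u p (lambda p)) :
  lambda p @[p --> 0^'+] --> lambda0.
Proof.
exact: (annealed_cvg kappa_gt0 h_gt0 h_le1 eta_supp xi_indep xi_law xi_esssup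
  u_sol lambda0_def lambda_def).
Qed.
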